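(* Let $S\subset\overline E$ be an additive subgroup containing $\mathbb Z$ all of whose elements have positive type. Then base change along $\mathbf O^\dagger\to\widehat{\mathbf O}$ induces a tensor equivalence of categories $\mathrm{MIC}^S(\mathbf O^\dagger)\to\mathrm{MIC}^S(\widehat{\mathbf O})$, where $\mathrm{MIC}^S(-)$ denotes the full subcategory of regular connections all of whose exponents lie in $S$.
   Context: Let $E$ be a field of characteristic $0$ with a valuation $v$ with $v(p)>0$, and $\overline E$ an algebraic closure with an extension of $v$. Let $\widehat{\mathbf O}=E[[z]]$ and $\mathbf O^\dagger\subset\widehat{\mathbf O}$ the subring of power series with positive radius of convergence ($=\bigcup_r E\langle z/p^r\rangle$). For $A\in\{\mathbf O^\dagger,\widehat{\mathbf O}\}$, $\mathrm{MIC}(A)$ is the category of finite free $A$-modules $M$ with an $E$-linear $\phi:M\to M$ satisfying $\phi(fx)=z\frac{df}{dz}x+f\phi(x)$; morphisms are $A$-linear maps commuting with $\phi$. Exponents: eigenvalues in $\overline E$ of the induced map on $M/zM$. For $\lambda\in\overline E$, $\mathrm{type}(\lambda)\in[0,1]$ is the radius of convergence of $\sum_{m\ge0,m\ne\lambda}z^m/(\lambda-m)$ (absolute value normalized by $|p|=p^{-1}$); ''positive type'' means $\mathrm{type}>0$. *)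

(* Defs.v *)
From HB Require Import structures.
From mathcomp Require Import all_boot all_order all_algebra.
From mathcomp Require Import all_classical all_reals.
From mathcomp Require Import ereal topology normedtype sequences.

Set Implicit Arguments.
Unset Strict Implicit.
Unset Printing Implicit Defensive.

Import Order.TTheory GRing.Theory Num.Theory.
Import numFieldNormedType.Exports.

Local Open Scope classical_set_scope.
Local Open Scope ring_scope.
Local Open Scope quotient_scope.

Record category := Category {
  obj :> Type;
  hom : obj -> obj -> Type;
  idm : forall X, hom X X;
  comp : forall X Y Z, hom Y Z -> hom X Y -> hom X Z;
  compA : forall X Y Z W (h : hom Z W) (g : hom Y Z) (f : hom X Y),
    comp h (comp g f) = comp (comp h g) f;
  comp1m : forall X Y (f : hom X Y), comp (idm Y) f = f;
  compm1 : forall X Y (f : hom X Y), comp f (idm X) = f }.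

Arguments hom {c} X Y.
Arguments idm {c} X.
Arguments comp {c X Y Z} _ _.

Notation "g \oc f" := (comp g f) (at level 40, left associativity).

Definition is_iso (C : category) (X Y : C) (f : hom X Y) : Prop :=
  exists g : hom Y X, g \oc f = idm X /\ f \oc g = idm Y.

Record functor (C D : category) := Functor {
  fobj :> C -> D;
  fmap : forall X Y, hom X Y -> hom (fobj X) (fobj Y);
  fmap_id : forall X, fmap (idm X) = idm (fobj X);
  fmap_comp : forall X Y Z (g : hom Y Z) (f : hom X Y),
    fmap (g \oc f) = fmap g \oc fmap f }.

Arguments fmap {C D} _ {X Y} _.

Definition functor_id (C : category) : functor C C :=
  @Functor C C id (fun _ _ f => f) (fun _ => erefl) (fun _ _ _ _ _ => erefl).

Definition functor_comp (C D E : category)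
    (G : functor D E) (F : functor C D) : functor C E.
Proof.
apply: (@Functor C E (fun X => G (F X)) (fun _ _ f => fmap G (fmap F f))).
- by move=> X; rewrite !fmap_id.
- by move=> X Y Z g f; rewrite !fmap_comp.
Defined.

Definition naturally_isomorphic (C D : category) (F G : functor C D) : Prop :=
  exists eta : forall X, hom (F X) (G X),
    (forall X, is_iso (eta X)) /\
    forall X Y (f : hom X Y), eta Y \oc fmap F f = fmap G f \oc eta X.

Definition is_equivalence (C D : category) (F : functor C D) : Prop :=
  exists G : functor D C,
    naturally_isomorphic (functor_comp G F) (functor_id C) /\
    naturally_isomorphic (functor_comp F G) (functor_id D).

(* Tensor category = symmetric monoidal category. *)
Record tensorCategory := TensorCategory {
  tc_cat :> category;
  tens : tc_cat -> tc_cat -> tc_cat;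
  tensm : forall X X' Y Y' : tc_cat,
    hom X X' -> hom Y Y' -> hom (tens X Y) (tens X' Y');
  tunit : tc_cat;
  assoc : forall X Y Z, hom (tens (tens X Y) Z) (tens X (tens Y Z));
  lunit : forall X, hom (tens tunit X) X;
  runit : forall X, hom (tens X tunit) X;
  braid : forall X Y, hom (tens X Y) (tens Y X);
  tensm_id : forall X Y, tensm (idm X) (idm Y) = idm (tens X Y);
  tensm_comp : forall X X' X'' Y Y' Y'' (f' : hom X' X'') (f : hom X X')
      (g' : hom Y' Y'') (g : hom Y Y'),
    tensm (f' \oc f) (g' \oc g) = tensm f' g' \oc tensm f g;
  assoc_iso : forall X Y Z, is_iso (assoc X Y Z);
  lunit_iso : forall X, is_iso (lunit X);
  runit_iso : forall X, is_iso (runit X);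
  assoc_nat : forall X X' Y Y' Z Z'
      (f : hom X X') (g : hom Y Y') (h : hom Z Z'),
    assoc X' Y' Z' \oc tensm (tensm f g) h =
    tensm f (tensm g h) \oc assoc X Y Z;
  lunit_nat : forall X Y (f : hom X Y),
    lunit Y \oc tensm (idm tunit) f = f \oc lunit X;
  runit_nat : forall X Y (f : hom X Y),
    runit Y \oc tensm f (idm tunit) = f \oc runit X;
  braid_nat : forall X X' Y Y' (f : hom X X') (g : hom Y Y'),
    braid X' Y' \oc tensm f g = tensm g f \oc braid X Y;
  braidK : forall X Y, braid Y X \oc braid X Y = idm (tens X Y);
  pentagon : forall X Y Z W,
    assoc X Y (tens Z W) \oc assoc (tens X Y) Z W =
    tensm (idm X) (assoc Y Z W) \oc assoc X (tens Y Z) W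
      \oc tensm (assoc X Y Z) (idm W);
  triangle : forall X Y,
    tensm (idm X) (lunit Y) \oc assoc X tunit Y = tensm (runit X) (idm Y);
  hexagon : forall X Y Z,
    assoc Y Z X \oc braid X (tens Y Z) \oc assoc X Y Z =
    tensm (idm Y) (braid X Z) \oc assoc Y X Z \oc tensm (braid X Y) (idm Z) }.

Arguments tens {t} X Y.
Arguments tensm {t X X' Y Y'} _ _.
Arguments tunit {t}.

Record tensorFunctor (C D : tensorCategory) := TensorFunctor {
  tf_functor :> functor C D;
  tf_mul : forall X Y, hom (tens (tf_functor X) (tf_functor Y))
                           (tf_functor (tens X Y));
  tf_one : hom tunit (tf_functor tunit);
  tf_mul_iso : forall X Y, is_iso (tf_mul X Y);
  tf_one_iso : is_iso tf_one;
  tf_mul_nat : forall X X' Y Y' (f : hom X X') (g : hom Y Y'),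
    tf_mul X' Y' \oc tensm (fmap tf_functor f) (fmap tf_functor g) =
    fmap tf_functor (tensm f g) \oc tf_mul X Y;
  tf_assoc : forall X Y Z,
    fmap tf_functor (assoc X Y Z) \oc tf_mul (tens X Y) Z
      \oc tensm (tf_mul X Y) (idm (tf_functor Z)) =
    tf_mul X (tens Y Z) \oc tensm (idm (tf_functor X)) (tf_mul Y Z)
      \oc assoc (tf_functor X) (tf_functor Y) (tf_functor Z);
  tf_lunit : forall X,
    fmap tf_functor (lunit X) \oc tf_mul tunit X
      \oc tensm tf_one (idm (tf_functor X)) = lunit (tf_functor X);
  tf_runit : forall X,
    fmap tf_functor (runit X) \oc tf_mul X tunit
      \oc tensm (idm (tf_functor X)) tf_one = runit (tf_functor X);
  tf_braid : forall X Y,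
    fmap tf_functor (braid X Y) \oc tf_mul X Y =
    tf_mul Y X \oc braid (tf_functor X) (tf_functor Y) }.

Definition is_tensor_equivalence (C D : tensorCategory)
    (F : tensorFunctor C D) : Prop := is_equivalence F.

Definition tensor_stable (C : tensorCategory) (P : C -> Prop) : Prop :=
  P tunit /\ forall X Y, P X -> P Y -> P (tens X Y).

Section FullSubcategory.
Variables (C : tensorCategory) (P : C -> Prop) (stP : tensor_stable P).

Definition full_cat : category :=
  @Category {X : C | P X} (fun X Y => hom (sval X) (sval Y))
    (fun X => idm (sval X)) (fun _ _ _ g f => g \oc f)
    (fun _ _ _ _ => @compA C _ _ _ _) (fun _ _ => @comp1m C _ _)
    (fun _ _ => @compm1 C _ _).

Definition full_sub : tensorCategory :=
  @TensorCategory full_cat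
    (fun X Y => exist _ (tens (sval X) (sval Y))
                        (stP.2 _ _ (svalP X) (svalP Y)))
    (fun _ _ _ _ f g => @tensm C _ _ _ _ f g)
    (exist _ tunit stP.1)
    (fun X Y Z => assoc (sval X) (sval Y) (sval Z))
    (fun X => lunit (sval X)) (fun X => runit (sval X))
    (fun X Y => braid (sval X) (sval Y))
    (fun _ _ => @tensm_id C _ _) (fun _ _ _ _ _ _ => @tensm_comp C _ _ _ _ _ _)
    (fun X Y Z => @assoc_iso C _ _ _) (fun X => @lunit_iso C _)
    (fun X => @runit_iso C _)
    (fun _ _ _ _ _ _ => @assoc_nat C _ _ _ _ _ _) (fun _ _ => @lunit_nat C _ _)
    (fun _ _ => @runit_nat C _ _) (fun _ _ _ _ => @braid_nat C _ _ _ _)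
    (fun _ _ => @braidK C _ _) (fun _ _ _ _ => @pentagon C _ _ _ _)
    (fun _ _ => @triangle C _ _) (fun _ _ _ => @hexagon C _ _ _).

End FullSubcategory.

Section FullFunctor.
Variables (C D : tensorCategory) (F : tensorFunctor C D).
Variables (P : C -> Prop) (stP : tensor_stable P).
Variables (Q : D -> Prop) (stQ : tensor_stable Q).
Hypothesis PQ : forall X, P X -> Q (F X).

Definition full_functor : functor (full_sub stP) (full_sub stQ) :=
  @Functor (full_sub stP) (full_sub stQ)
    (fun X => exist _ (F (sval X)) (PQ (svalP X)))
    (fun _ _ f => @fmap C D F _ _ f)
    (fun _ => @fmap_id C D F _) (fun _ _ _ => @fmap_comp C D F _ _ _).

Definition full_tensor_functor : tensorFunctor (full_sub stP) (full_sub stQ) :=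
  @TensorFunctor (full_sub stP) (full_sub stQ) full_functor
    (fun X Y => tf_mul F (sval X) (sval Y)) (tf_one F)
    (fun _ _ => @tf_mul_iso C D F _ _) (tf_one_iso F)
    (fun _ _ _ _ => @tf_mul_nat C D F _ _ _ _)
    (fun _ _ _ => @tf_assoc C D F _ _ _) (fun _ => @tf_lunit C D F _)
    (fun _ => @tf_runit C D F _) (fun _ _ => @tf_braid C D F _ _).

End FullFunctor.

Section TensorProduct.
Variables (A : comNzRingType) (M N : lmodType A).

Definition balanced (P : zmodType) (f : M -> N -> P) : Prop :=
  [/\ forall n, {morph f^~ n : x y / x + y},
      forall m, {morph f m : x y / x + y} &
      forall a m n, f (a *: m) n = f m (a *: n)].

Definition teval (P : zmodType) (f : M -> N -> P) (s : seq (M * N)) : P :=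
  \sum_(x <- s) f x.1 x.2.

(* The list s stands for the formal sum of the tensors m (x) n for (m, n) in  *)
(* s; two formal sums are identified when no balanced map separates them, so  *)
(* that the quotient carries the universal balanced map.                      *)
Definition teq : rel (seq (M * N)) := fun s t =>
  `[< forall (P : zmodType) (f : M -> N -> P),
        balanced f -> teval f s = teval f t >].

Lemma teq_equiv : equiv_class_of teq.
Proof.
split=> [s|s t|t s u].
- by apply/asboolP.
- by apply/asboolP/asboolP => h P f bf; rewrite h.
- by move=> /asboolP h /asboolP k; apply/asboolP => P f bf; rewrite h ?k.
Qed.

Canonical teq_equivRel := EquivRelPack teq_equiv.

Definition tensor : Type := {eq_quot teq}.
HB.instance Definition _ := Choice.on tensor.
HB.instance Definition _ := EqQuotient.on tensor.

Definition tlift (P : zmodType) (f : M -> N -> P) (x : tensor) : P :=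
  teval f (repr x).

Lemma tlift_pi (P : zmodType) (f : M -> N -> P) s :
  balanced f -> tlift f (\pi_tensor s) = teval f s.
Proof.
move=> bf; rewrite /tlift.
have /eqmodP/asboolP : repr (\pi_tensor s) = s %[mod tensor] by rewrite reprK.
exact.
Qed.

Lemma tensor_sep (x y : tensor) :
  (forall (P : zmodType) (f : M -> N -> P), balanced f ->
     tlift f x = tlift f y) -> x = y.
Proof.
rewrite -[x]reprK -[y]reprK => h; apply/eqmodP/asboolP => P f bf.
by have := h P f bf; rewrite !tlift_pi.
Qed.

Definition tzero : tensor := \pi_tensor [::].
Definition tadd (x y : tensor) : tensor := \pi_tensor (repr x ++ repr y).
Definition topp (x : tensor) : tensor :=
  \pi_tensor [seq (- z.1, z.2) | z <- repr x].

Lemma tlift0_ (P : zmodType) (f : M -> N -> P) : balanced f -> tlift f tzero = 0.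
Proof. by move=> bf; rewrite tlift_pi// /teval big_nil. Qed.

Lemma tliftD_ (P : zmodType) (f : M -> N -> P) : balanced f ->
  {morph tlift f : x y / tadd x y >-> x + y}.
Proof. by move=> bf x y; rewrite tlift_pi// /teval big_cat. Qed.

Lemma balanced0l (P : zmodType) (f : M -> N -> P) n : balanced f -> f 0 n = 0.
Proof.
by case=> fD _ _; apply: (addrI (f 0 n)); rewrite -[LHS]fD !addr0.
Qed.

Lemma balanced0r (P : zmodType) (f : M -> N -> P) m : balanced f -> f m 0 = 0.
Proof.
by case=> _ fD _; apply: (addrI (f m 0)); rewrite -[LHS]fD !addr0.
Qed.

Lemma balancedNl (P : zmodType) (f : M -> N -> P) m n :
  balanced f -> f (- m) n = - f m n.
Proof.
move=> bf; apply: (addrI (f m n)).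
by case: (bf) => fD _ _; rewrite -[LHS]fD !subrr (balanced0l _ bf).
Qed.

Lemma tliftN_ (P : zmodType) (f : M -> N -> P) : balanced f ->
  {morph tlift f : x / topp x >-> - x}.
Proof.
move=> bf x; rewrite tlift_pi// /tlift /teval big_map /= -sumrN.
by apply: eq_bigr => z _; rewrite balancedNl.
Qed.

Lemma taddA : associative tadd.
Proof. by move=> x y z; apply: tensor_sep => P f bf; rewrite !tliftD_// addrA. Qed.
Lemma taddC : commutative tadd.
Proof. by move=> x y; apply: tensor_sep => P f bf; rewrite !tliftD_// addrC. Qed.
Lemma tadd0 : left_id tzero tadd.
Proof.
by move=> x; apply: tensor_sep => P f bf; rewrite tliftD_// tlift0_// add0r.
Qed.
Lemma taddN : left_inverse tzero topp tadd.
Proof.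
move=> x; apply: tensor_sep => P f bf.
by rewrite tliftD_// tliftN_// tlift0_// addNr.
Qed.

HB.instance Definition _ :=
  GRing.isZmodule.Build tensor taddA taddC tadd0 taddN.

Definition pure (m : M) (n : N) : tensor := \pi_tensor [:: (m, n)].

Lemma tlift_pure (P : zmodType) (f : M -> N -> P) m n :
  balanced f -> tlift f (pure m n) = f m n.
Proof. by move=> bf; rewrite tlift_pi// /teval big_seq1. Qed.

Lemma tliftD (P : zmodType) (f : M -> N -> P) : balanced f ->
  {morph tlift f : x y / x + y}.
Proof. exact: tliftD_. Qed.

Lemma pure_balanced : balanced pure.
Proof.
split=> [n x y|m x y|a m n]; apply: tensor_sep => P f bf;
  rewrite ?tliftD// !tlift_pure//;
  by case: bf => h1 h2 h3; first [exact: h1 | exact: h2 | exact: h3].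
Qed.

Lemma pureDl m m' n : pure (m + m') n = pure m n + pure m' n.
Proof. by case: pure_balanced => h _ _; exact: h. Qed.
Lemma pureDr m n n' : pure m (n + n') = pure m n + pure m n'.
Proof. by case: pure_balanced => _ h _; exact: h. Qed.
Lemma pureZ a m n : pure (a *: m) n = pure m (a *: n).
Proof. by case: pure_balanced => _ _ ->. Qed.

Lemma tensorE (x : tensor) : x = \sum_(z <- repr x) pure z.1 z.2.
Proof.
apply: tensor_sep => P f bf; rewrite {1}/tlift /teval.
elim: (repr x) => [|z s IH]; first by rewrite !big_nil tlift0_.
by rewrite !big_cons tliftD// tlift_pure// IH.
Qed.

Lemma additive0 (U V : zmodType) (g : U -> V) :
  {morph g : x y / x + y} -> g 0 = 0.
Proof. by move=> gD; apply: (addrI (g 0)); rewrite -gD !addr0. Qed.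

Lemma tensor_ext (P : zmodType) (g h : tensor -> P) :
  {morph g : x y / x + y} -> {morph h : x y / x + y} ->
  (forall m n, g (pure m n) = h (pure m n)) -> g =1 h.
Proof.
move=> gD hD gh x; rewrite [x]tensorE.
elim: (repr x) => [|z s IH]; first by rewrite big_nil !additive0.
by rewrite big_cons gD hD gh IH.
Qed.

Lemma tensor_universal (P : zmodType) (f : M -> N -> P) : balanced f ->
  exists! g : tensor -> P,
    {morph g : x y / x + y} /\ forall m n, g (pure m n) = f m n.
Proof.
move=> bf; exists (tlift f); split.
  by split=> [|m n]; [exact: tliftD | rewrite tlift_pure].
move=> g [gD gp]; apply/funext; apply: tensor_ext => //; first exact: tliftD.
by move=> m n; rewrite tlift_pure// gp.
Qed.

Definition tscale (a : A) : tensor -> tensor := tlift (fun m n => pure (a *: m) n).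

Lemma tscale_balanced a : balanced (fun m n => pure (a *: m) n).
Proof.
split=> [n x y|m x y|b m n]; first by rewrite scalerDr pureDl.
  by rewrite pureDr.
by rewrite scalerA mulrC -scalerA pureZ.
Qed.

Lemma tscaleD a : {morph tscale a : x y / x + y}.
Proof. exact/tliftD/tscale_balanced. Qed.
Lemma tscale_pure a m n : tscale a (pure m n) = pure (a *: m) n.
Proof. exact/tlift_pure/tscale_balanced. Qed.

Lemma tscaleA a b x : tscale a (tscale b x) = tscale (a * b) x.
Proof.
move: x; apply: tensor_ext => [x y|x y|m n]; rewrite ?tscaleD//.
by rewrite !tscale_pure scalerA.
Qed.
Lemma tscale1 : left_id 1 tscale.
Proof.
apply: tensor_ext => [x y|x y|m n]; rewrite ?tscaleD//.
by rewrite tscale_pure scale1r.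
Qed.
Lemma tscaleDr : right_distributive tscale +%R.
Proof. by move=> a x y; rewrite tscaleD. Qed.
Lemma tscaleDl x : {morph tscale^~ x : a b / a + b}.
Proof.
move=> a b; move: x; apply: tensor_ext => [x y|x y|m n]; rewrite /= ?tscaleD//.
  by rewrite addrACA.
by rewrite !tscale_pure scalerDl pureDl.
Qed.

HB.instance Definition _ :=
  GRing.Zmodule_isLmodule.Build A tensor tscaleA tscale1 tscaleDr tscaleDl.

Lemma scale_pure a m n : a *: pure m n = pure (a *: m) n.
Proof. exact: tscale_pure. Qed.

End TensorProduct.

Notation "m %(x) n" := (pure m n) (at level 40, format "m  %(x)  n").

Record diffRing := DiffRing {
  dring :> comNzRingType;
  der : dring -> dring;
  derD : {morph der : f g / f + g};
  derM : forall f g, der (f * g) = der f * g + f * der g }.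

Lemma der1 (D : diffRing) : der (1 : D) = 0.
Proof.
by apply: (addrI (der 1)); rewrite addr0 -[in RHS](mulr1 1) derM mulr1 mul1r.
Qed.

Record diffMorph (A B : diffRing) := DiffMorph {
  dmorph :> {rmorphism A -> B};
  dmorph_der : forall f, dmorph (der f) = der (dmorph f) }.

Record dmod (D : diffRing) := Dmod {
  dmod_mod :> lmodType D;
  nabla : dmod_mod -> dmod_mod;
  nablaD : {morph nabla : x y / x + y};
  nablaZ : forall (f : D) x, nabla (f *: x) = der f *: x + f *: nabla x }.

Record dhom (D : diffRing) (M N : dmod D) := Dhom {
  dfun :> M -> N;
  dfun_linear : linear dfun;
  dfun_nabla : forall x, dfun (nabla x) = nabla (dfun x) }.

Section DmodCategory.
Variable D : diffRing.
Implicit Types M N P Q : dmod D.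

Lemma dhom_ext M N (f g : dhom M N) : f =1 g -> f = g.
Proof.
case: f g => [f f1 f2] [g g1 g2] /= /funext fg; move: f1 f2; rewrite fg => f1 f2.
by congr Dhom; exact: Prop_irrelevance.
Qed.

Lemma linD (V W : lmodType D) (f : V -> W) :
  linear f -> {morph f : x y / x + y}.
Proof. by move=> h x y; have := h 1 x y; rewrite !scale1r. Qed.

Lemma linZ (V W : lmodType D) (f : V -> W) :
  linear f -> forall a x, f (a *: x) = a *: f x.
Proof.
move=> h a x; have := h a x 0; rewrite !addr0 => ->.
by rewrite (additive0 (linD h)) addr0.
Qed.

Lemma lin_mk (V W : lmodType D) (f : V -> W) :
  {morph f : x y / x + y} -> (forall a x, f (a *: x) = a *: f x) -> linear f.
Proof. by move=> fD fZ a x y; rewrite fD fZ. Qed.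

Definition dhomD M N (f : dhom M N) := linD (dfun_linear f).
Definition dhomZ M N (f : dhom M N) := linZ (dfun_linear f).

Lemma id_linear M : linear (@id M). Proof. by []. Qed.
Definition dhom_id M : dhom M M := @Dhom D M M id (@id_linear M) (fun _ => erefl).

Definition dhom_comp M N P (g : dhom N P) (f : dhom M N) : dhom M P.
Proof.
apply: (@Dhom D M P (fun x => g (f x))).
- by apply: lin_mk => [x y|a x]; rewrite ?dhomD ?dhomZ.
- by move=> x; rewrite !dfun_nabla.
Defined.

Definition dmod_cat : category.
Proof.
apply: (@Category (dmod D) (@dhom D) dhom_id dhom_comp);
  by move=> *; apply: dhom_ext.
Defined.

Lemma tlift_linear (V W X : lmodType D) (f : V -> W -> X) : balanced f ->
  (forall a v w, f (a *: v) w = a *: f v w) -> linear (tlift f).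
Proof.
move=> bf fZ; apply: lin_mk => [|a]; first exact: tliftD.
apply: tensor_ext => [x y|x y|v w].
- by rewrite scalerDr tliftD.
- by rewrite tliftD// scalerDr.
- by rewrite scale_pure !tlift_pure// fZ.
Qed.

Definition tnabla M N : tensor M N -> tensor M N :=
  tlift (fun m n => nabla m %(x) n + m %(x) nabla n).

Lemma tnabla_balanced M N :
  balanced (fun (m : M) (n : N) => nabla m %(x) n + m %(x) nabla n).
Proof.
split=> [n x y|m x y|a m n].
- by rewrite nablaD !pureDl addrACA.
- by rewrite nablaD !pureDr addrACA.
- by rewrite !nablaZ !pureDl !pureDr -!pureZ [in RHS]addrCA addrA.
Qed.

Lemma tnabla_pure M N (m : M) (n : N) :
  tnabla (m %(x) n) = nabla m %(x) n + m %(x) nabla n.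
Proof. exact/tlift_pure/tnabla_balanced. Qed.

Lemma tnablaD M N : {morph @tnabla M N : x y / x + y}.
Proof. exact/tliftD/tnabla_balanced. Qed.

Lemma tnablaZ M N (a : D) (x : tensor M N) :
  tnabla (a *: x) = der a *: x + a *: tnabla x.
Proof.
move: x; apply: tensor_ext => [x y|x y|m n].
- by rewrite scalerDr tnablaD.
- by rewrite tnablaD !scalerDr addrACA.
- by rewrite tnabla_pure scalerDr !scale_pure tnabla_pure nablaZ !pureDl addrA.
Qed.

Definition dtens M N : dmod D := Dmod (@tnablaD M N) (@tnablaZ M N).

Definition tlift_hom M N P (f : M -> N -> P) (bf : balanced f)
    (fZ : forall a m n, f (a *: m) n = a *: f m n)
    (fN : forall m n, f (nabla m) n + f m (nabla n) = nabla (f m n)) :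
  dhom (dtens M N) P.
Proof.
apply: (@Dhom D (dtens M N) P (tlift f) (tlift_linear bf fZ)).
apply: tensor_ext => [x y|x y|m n]; rewrite /= ?tnablaD ?tliftD ?nablaD//.
by rewrite tnabla_pure tliftD// !tlift_pure.
Defined.

Lemma tlift_homE M N P (f : M -> N -> P) bf fZ fN m n :
  @tlift_hom M N P f bf fZ fN (m %(x) n) = f m n.
Proof. exact: tlift_pure. Qed.

Lemma dhom_ext2 M N P (f g : dhom (dtens M N) P) :
  (forall m n, f (m %(x) n) = g (m %(x) n)) -> f = g.
Proof.
move=> fg; apply/dhom_ext/tensor_ext => //; [exact: (dhomD f) | exact: (dhomD g)].
Qed.

Lemma dhom_ext3 M N P Q (f g : dhom (dtens (dtens M N) P) Q) :
  (forall m n p, f (m %(x) n %(x) p) = g (m %(x) n %(x) p)) -> f = g.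
Proof.
move=> fg; apply: dhom_ext2 => x p; move: x.
by apply: tensor_ext => // x y; rewrite pureDl dhomD.
Qed.

Lemma dhom_ext4 M N P Q R (f g : dhom (dtens (dtens (dtens M N) P) Q) R) :
  (forall m n p q, f (m %(x) n %(x) p %(x) q) = g (m %(x) n %(x) p %(x) q)) ->
  f = g.
Proof.
move=> fg; apply: dhom_ext3 => x p q; move: x.
by apply: tensor_ext => // x y; rewrite !pureDl dhomD.
Qed.

Definition dtensm M M' N N' (f : dhom M M') (g : dhom N N') :
  dhom (dtens M N) (dtens M' N').
Proof.
apply: (@tlift_hom M N (dtens M' N') (fun m n => f m %(x) g n)).
- split=> [n x y|m x y|a m n].
  + by rewrite dhomD pureDl.
  + by rewrite dhomD pureDr.
  + by rewrite !dhomZ pureZ.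
- by move=> a m n; rewrite dhomZ scale_pure.
- by move=> m n; rewrite !dfun_nabla /= tnabla_pure.
Defined.

Lemma dtensmE M M' N N' (f : dhom M M') (g : dhom N N') m n :
  dtensm f g (m %(x) n) = f m %(x) g n.
Proof. exact: tlift_homE. Qed.

Definition dunit : dmod D :=
  @Dmod D D^o (@der D) (@derD D) (@derM D).

Definition dlunit M : dhom (dtens dunit M) M.
Proof.
apply: (@tlift_hom dunit M M (fun (a : D) m => a *: m)).
- split=> [n x y|m x y|a m n].
  + by rewrite scalerDl.
  + by rewrite scalerDr.
  + by rewrite scalerA mulrC.
- by move=> a m n; rewrite -scalerA.
- by move=> a m; rewrite nablaZ.
Defined.

Definition drunit M : dhom (dtens M dunit) M.
Proof.
apply: (@tlift_hom M dunit M (fun m (a : D) => a *: m)).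
- split=> [n x y|m x y|a m n].
  + by rewrite scalerDr.
  + by rewrite scalerDl.
  + by rewrite scalerA mulrC.
- by move=> a m n; rewrite !scalerA mulrC.
- by move=> m a; rewrite nablaZ addrC.
Defined.

Definition dbraid M N : dhom (dtens M N) (dtens N M).
Proof.
apply: (@tlift_hom M N (dtens N M) (fun m n => n %(x) m)).
- split=> [n x y|m x y|a m n].
  + by rewrite pureDr.
  + by rewrite pureDl.
  + by rewrite pureZ.
- by move=> a m n; rewrite scale_pure pureZ.
- by move=> m n; rewrite /= tnabla_pure addrC.
Defined.

Lemma dlunitE M (a : D) (m : M) : dlunit M ((a : dunit) %(x) m) = a *: m.
Proof. exact: tlift_homE. Qed.
Lemma drunitE M (a : D) (m : M) : drunit M (m %(x) (a : dunit)) = a *: m.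
Proof. exact: tlift_homE. Qed.
Lemma dbraidE M N (m : M) (n : N) : dbraid M N (m %(x) n) = n %(x) m.
Proof. exact: tlift_homE. Qed.

Section Associator.
Variables M N P : dmod D.

Definition assoc_fun (x : tensor M N) (p : P) : tensor M (dtens N P) :=
  tlift (fun m n => m %(x) ((n %(x) p) : dtens N P)) x.

Lemma assoc_bal p :
  balanced (fun (m : M) (n : N) => m %(x) ((n %(x) p) : dtens N P)).
Proof.
split=> [n x y|m x y|a m n].
- by rewrite pureDl.
- by rewrite pureDl pureDr.
- by rewrite pureZ scale_pure.
Qed.

Lemma assoc_fun_pure m n p :
  assoc_fun (m %(x) n) p = m %(x) ((n %(x) p) : dtens N P).
Proof. exact/tlift_pure/assoc_bal. Qed.

Lemma assoc_funD p : {morph assoc_fun^~ p : x y / x + y}.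
Proof. exact/tliftD/assoc_bal. Qed.

Lemma assoc_funZ a x p : assoc_fun (a *: x) p = a *: assoc_fun x p.
Proof.
apply: linZ; apply: tlift_linear => [|b m n]; first exact: assoc_bal.
by rewrite scale_pure.
Qed.

Definition dassoc : dhom (dtens (dtens M N) P) (dtens M (dtens N P)).
Proof.
apply: (@tlift_hom (dtens M N) P (dtens M (dtens N P)) assoc_fun).
- split=> [p|x p q|a x p]; first exact: assoc_funD.
  + move: x; apply: tensor_ext => [x y|x y|m n].
    * exact: assoc_funD.
    * by rewrite !assoc_funD addrACA.
    * by rewrite !assoc_fun_pure !pureDr.
  + rewrite assoc_funZ; move: x; apply: tensor_ext => [x y|x y|m n].
    * by rewrite assoc_funD scalerDr.
    * by rewrite assoc_funD.
    * by rewrite !assoc_fun_pure scale_pure pureZ -[in RHS]pureZ scale_pure.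
- exact: assoc_funZ.
- move=> x p; move: x; apply: tensor_ext => [x y|x y|m n].
  + by rewrite nablaD !assoc_funD addrACA.
  + by rewrite assoc_funD nablaD.
  + rewrite /= tnabla_pure assoc_funD !assoc_fun_pure tnabla_pure /=.
    by rewrite tnabla_pure pureDr addrA.
Defined.

Lemma dassocE m n p :
  dassoc (((m %(x) n) : dtens M N) %(x) p) = m %(x) ((n %(x) p) : dtens N P).
Proof. by rewrite /dassoc tlift_homE assoc_fun_pure. Qed.

End Associator.

Lemma dcompE M N P (g : dhom N P) (f : dhom M N) x :
  dhom_comp g f x = g (f x).
Proof. by []. Qed.
Lemma dcompE' M N P (g : dhom N P) (f : dhom M N) x :
  dfun (@comp dmod_cat M N P g f) x = g (f x).
Proof. by []. Qed.
Lemma didE M x : dhom_id M x = x. Proof. by []. Qed.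
Lemma didE' M x : dfun (@idm dmod_cat M) x = x. Proof. by []. Qed.

Definition tcE := (dtensmE, dlunitE, drunitE, dbraidE, dassocE,
  dcompE, dcompE', didE, didE').

Definition dmod_tensor : tensorCategory.
Proof.
apply: (@TensorCategory dmod_cat dtens dtensm dunit dassoc dlunit drunit dbraid).
- by move=> M N; apply: dhom_ext2 => m n; rewrite !tcE.
- by move=> *; apply: dhom_ext2 => m n; rewrite !tcE.
- move=> M N P.
  pose g := dhom_comp (dtensm (dbraid N M) (dhom_id P))
    (dhom_comp (dbraid P (dtens N M)) (dhom_comp (dassoc P N M)
      (dhom_comp (dtensm (dbraid N P) (dhom_id M)) (dbraid M (dtens N P))))).
  exists g; split; first by apply: dhom_ext3 => m n p; rewrite !tcE.
  apply: dhom_ext2 => m x; move: x; apply: tensor_ext => [x y|x y|n p].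
  + by rewrite pureDr dhomD.
  + by rewrite pureDr dhomD.
  + by rewrite !tcE.
- move=> M.
  have h1 : linear (fun m : M => (1 : dunit) %(x) m).
    by apply: lin_mk => [x y|a x]; rewrite ?pureDr// -pureZ scale_pure.
  have h2 (m : M) : (1 : dunit) %(x) nabla m = tnabla ((1 : dunit) %(x) m).
    by rewrite tnabla_pure /= der1 (balanced0l _ (@pure_balanced _ _ _)) add0r.
  exists (@Dhom D M (dtens dunit M) _ h1 h2); split.
    by apply: dhom_ext2 => a m; rewrite !tcE /= -pureZ /GRing.scale/= mulr1.
  by apply: dhom_ext => m; rewrite dcompE' [X in X = _]tcE scale1r.
- move=> M.
  have h1 : linear (fun m : M => m %(x) (1 : dunit)).
    by apply: lin_mk => [x y|a x]; rewrite ?pureDl// scale_pure.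
  have h2 (m : M) : nabla m %(x) (1 : dunit) = tnabla (m %(x) (1 : dunit)).
    by rewrite tnabla_pure /= der1 (balanced0r _ (@pure_balanced _ _ _)) addr0.
  exists (@Dhom D M (dtens M dunit) _ h1 h2); split.
    by apply: dhom_ext2 => m a; rewrite !tcE /= pureZ /GRing.scale/= mulr1.
  by apply: dhom_ext => m; rewrite dcompE' [X in X = _]tcE scale1r.
- by move=> *; apply: dhom_ext3 => m n p; rewrite !tcE.
- by move=> *; apply: dhom_ext2 => a m; rewrite !tcE dhomZ.
- by move=> *; apply: dhom_ext2 => m a; rewrite !tcE dhomZ.
- by move=> *; apply: dhom_ext2 => m n; rewrite !tcE.
- by move=> *; apply: dhom_ext2 => m n; rewrite !tcE.
- by move=> *; apply: dhom_ext4 => m n p q; rewrite !tcE.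
- by move=> *; apply: dhom_ext3 => m a n; rewrite !tcE pureZ.
- by move=> *; apply: dhom_ext3 => m n p; rewrite !tcE.
Defined.

End DmodCategory.

Definition finite_free (A : comNzRingType) (M : lmodType A) : Prop :=
  exists (I : finType) (e : I -> M),
    forall x, exists! c : {ffun I -> A}, x = \sum_i c i *: e i.

Section FiniteFree.
Variable A : comNzRingType.

Definition coords (M : lmodType A) (I : finType) (e : I -> M)
    (k : I -> M -> A) : Prop :=
  [/\ forall i, {morph k i : x y / x + y},
      forall i a x, k i (a *: x) = a * k i x,
      forall i j, k i (e j) = (i == j)%:R &
      forall x, x = \sum_i k i x *: e i].

Lemma finite_freeP (M : lmodType A) :
  finite_free M <-> exists (I : finType) (e : I -> M) k, coords e k.
Proof.
split=> [[I [e he]]|[I [e [k [kD kZ ke kE]]]]]; last first.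
  exists I, e => x; exists [ffun i => k i x]; split.
    by rewrite {1}[x]kE; apply: eq_bigr => i _; rewrite ffunE.
  move=> c ->; apply/ffunP => i; rewrite ffunE.
  rewrite (big_morph (k i) (kD i) (additive0 (kD i))) (bigD1 i)//= kZ ke eqxx.
  rewrite mulr1 big1 ?addr0// => j ji; rewrite kZ ke eq_sym (negbTE ji).
  by rewrite mulr0.
have [c hc] := choice he.
have hcE x i b : x = \sum_i b i *: e i -> c x i = b i.
  move=> xb; have [_ /(_ [ffun i => b i])] := hc x.
  move=> ->; first by rewrite ffunE.
  by rewrite {1}xb; apply: eq_bigr => j _; rewrite ffunE.
exists I, e, (fun i x => c x i); split=> [i x y|i a x|i j|x].
- apply: (hcE _ _ (fun i => c x i + c y i)).
  rewrite {1}(hc x).1 {1}(hc y).1 -big_split.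
  by apply: eq_bigr => l _; rewrite scalerDl.
- apply: (hcE _ _ (fun i => a * c x i)); rewrite {1}(hc x).1 scaler_sumr.
  by apply: eq_bigr => l _; rewrite scalerA.
- apply: (hcE _ _ (fun i => (i == j)%:R)).
  rewrite (bigD1 j)//= eqxx scale1r big1 ?addr0// => l /negbTE->.
  by rewrite scale0r.
- exact: (hc x).1.
Qed.

Lemma finite_free_unit : finite_free (A^o : lmodType A).
Proof.
apply/finite_freeP; exists unit, (fun=> 1), (fun _ x => x).
split=> // x; by rewrite (big_pred1 tt) => [|[]//]; rewrite /GRing.scale/= mulr1.
Qed.

Lemma finite_free_tensor (M N : lmodType A) :
  finite_free M -> finite_free N -> finite_free (tensor M N).
Proof.
move=> /finite_freeP[I [e [k [kD kZ ke kE]]]].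
move=> /finite_freeP[J [f [l [lD lZ lf lE]]]].
apply/finite_freeP; exists (I * J)%type, (fun ij => e ij.1 %(x) f ij.2).
have bal ij : balanced (fun m n => (k ij.1 m * l ij.2 n : A)).
  split=> [n x y|m x y|a m n]; first by rewrite kD mulrDl.
    by rewrite lD mulrDr.
  by rewrite kZ lZ -mulrA mulrCA.
exists (fun ij => tlift (fun m n => k ij.1 m * l ij.2 n)); split=> [ij|ij a|[i j] [i' j']|].
- exact: tliftD.
- apply: tensor_ext => [x y|x y|m n].
  + by rewrite scalerDr tliftD.
  + by rewrite tliftD// mulrDr.
  + by rewrite scale_pure !tlift_pure// kZ mulrA.
- by rewrite tlift_pure// ke lf -natrM mulnb.
- apply: tensor_ext => // [x y|m n].
    rewrite -big_split; apply: eq_bigr => ij _.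
    by rewrite tliftD// scalerDl.
  rewrite {1}[m]kE {1}[n]lE.
  have pD := @pure_balanced A M N; case: (pD) => p1 p2 _.
  rewrite (big_morph (fun m => m %(x) _) (p1 _) (balanced0l _ pD)).
  under eq_bigr => i _ do
    rewrite (big_morph (fun n => _ %(x) n) (p2 _) (balanced0r _ pD)).
  rewrite pair_big/=; apply: eq_bigr => -[i j] _ /=.
  rewrite tlift_pure; last exact: (bal (i, j)).
  by rewrite -pureZ -scale_pure -scale_pure scalerA mulrC.
Qed.

End FiniteFree.

Definition dmod_free (D : diffRing) (M : dmod_tensor D) : Prop :=
  finite_free (M : dmod D).

Lemma dmod_free_stable (D : diffRing) : tensor_stable (@dmod_free D).
Proof.
by split=> [|M N]; [exact: finite_free_unit | exact: finite_free_tensor].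
Qed.

Definition MIC (D : diffRing) : tensorCategory := full_sub (@dmod_free_stable D).

Section BaseChangeModule.
Variables (A B : comNzRingType) (j : {rmorphism A -> B}).

(* B as an A-module through j. *)
Definition restr : Type := B.
HB.instance Definition _ := GRing.Zmodule.on restr.

Definition restr_scale (a : A) (b : restr) : restr := j a * (b : B).

Lemma restr_scaleA a b v : restr_scale a (restr_scale b v) = restr_scale (a * b) v.
Proof. by rewrite /restr_scale rmorphM mulrA. Qed.
Lemma restr_scale1 : left_id 1 restr_scale.
Proof. by move=> v; rewrite /restr_scale rmorph1 mul1r. Qed.
Lemma restr_scaleDr : right_distributive restr_scale +%R.
Proof. by move=> a x y; rewrite /restr_scale mulrDr. Qed.
Lemma restr_scaleDl v : {morph restr_scale^~ v : a b / a + b}.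
Proof. by move=> a b; rewrite /restr_scale rmorphD mulrDl. Qed.
HB.instance Definition _ := GRing.Zmodule_isLmodule.Build A restr
  restr_scaleA restr_scale1 restr_scaleDr restr_scaleDl.

Variable M : lmodType A.

Definition bc : Type := tensor restr M.
HB.instance Definition _ := GRing.Zmodule.on bc.

Definition bpure (b : B) (m : M) : bc := (b : restr) %(x) m.

Definition bc_scale (b : B) : bc -> bc :=
  @tlift A restr M bc (fun (c : B) m => bpure (b * c) m).

Lemma bpureDl b c m : bpure (b + c) m = bpure b m + bpure c m.
Proof. exact: pureDl. Qed.
Lemma bpureDr b m n : bpure b (m + n) = bpure b m + bpure b n.
Proof. exact: pureDr. Qed.
Lemma bpureZ a b m : bpure (j a * b) m = bpure b (a *: m).
Proof. exact: (@pureZ A restr M). Qed.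
Lemma bpure0l m : bpure 0 m = 0.
Proof. exact: (balanced0l m (@pure_balanced A restr M)). Qed.
Lemma bpure0r b : bpure b 0 = 0.
Proof. exact: (balanced0r (b : restr) (@pure_balanced A restr M)). Qed.

Definition bbalanced (P : zmodType) (f : B -> M -> P) : Prop :=
  @balanced A restr M P f.

Lemma bbalancedP (P : zmodType) (f : B -> M -> P) :
  (forall m, {morph f^~ m : x y / x + y}) ->
  (forall b, {morph f b : x y / x + y}) ->
  (forall a b m, f (j a * b) m = f b (a *: m)) -> bbalanced f.
Proof. by []. Qed.

Definition blift (P : zmodType) (f : B -> M -> P) : bc -> P := @tlift A restr M P f.

Lemma bliftE (P : zmodType) (f : B -> M -> P) b m :
  bbalanced f -> blift f (bpure b m) = f b m.
Proof. by move=> bf; rewrite /blift tlift_pure. Qed.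

Lemma bliftD (P : zmodType) (f : B -> M -> P) :
  bbalanced f -> {morph blift f : x y / x + y}.
Proof. exact: tliftD. Qed.

Lemma bc_ext (P : zmodType) (g h : bc -> P) :
  {morph g : x y / x + y} -> {morph h : x y / x + y} ->
  (forall b m, g (bpure b m) = h (bpure b m)) -> g =1 h.
Proof. exact: tensor_ext. Qed.

Lemma bc_scale_bal b : bbalanced (fun c m => bpure (b * c) m).
Proof.
apply: bbalancedP => [m x y|c x y|a c m].
- by rewrite mulrDr bpureDl.
- by rewrite bpureDr.
- by rewrite mulrCA bpureZ.
Qed.

Lemma bc_scaleDr : right_distributive bc_scale +%R.
Proof. by move=> b x y; apply: bliftD; exact: bc_scale_bal. Qed.
Lemma bc_scale_pure b c m : bc_scale b (bpure c m) = bpure (b * c) m.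
Proof. by apply: bliftE; exact: bc_scale_bal. Qed.
Lemma bc_scaleA a b x : bc_scale a (bc_scale b x) = bc_scale (a * b) x.
Proof.
move: x; apply: bc_ext => [x y|x y|c m]; rewrite ?bc_scaleDr//.
by rewrite !bc_scale_pure mulrA.
Qed.
Lemma bc_scale1 : left_id 1 bc_scale.
Proof.
by apply: bc_ext => [x y|x y|c m]; rewrite ?bc_scaleDr// bc_scale_pure mul1r.
Qed.
Lemma bc_scaleDl x : {morph bc_scale^~ x : a b / a + b}.
Proof.
move=> a b; move: x; apply: bc_ext => [x y|x y|c m].
- by rewrite bc_scaleDr.
- by rewrite !bc_scaleDr addrACA.
- by rewrite !bc_scale_pure mulrDl bpureDl.
Qed.
HB.instance Definition _ := GRing.Zmodule_isLmodule.Build B bc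
  bc_scaleA bc_scale1 bc_scaleDr bc_scaleDl.

Lemma scale_bpure b c m : b *: bpure c m = bpure (b * c) m.
Proof. exact: bc_scale_pure. Qed.

Lemma blift_linear (P : lmodType B) (f : B -> M -> P) : bbalanced f ->
  (forall b c m, f (b * c) m = b *: f c m) -> linear (blift f).
Proof.
move=> bf fZ b x y; rewrite bliftD//; congr (_ + _); move: x.
apply: bc_ext => [x x'|x x'|c m].
- by rewrite scalerDr bliftD.
- by rewrite bliftD// scalerDr.
- by rewrite scale_bpure !bliftE// fZ.
Qed.

Lemma finite_free_bc : finite_free M -> finite_free bc.
Proof.
move=> /finite_freeP[I [e [k [kD kZ ke kE]]]].
apply/finite_freeP; exists I, (fun i => bpure 1 (e i)).
have bal i : bbalanced (fun b m => b * j (k i m)).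
  apply: bbalancedP => [m x y|c x y|a c m].
  - by rewrite mulrDl.
  - by rewrite kD rmorphD mulrDr.
  - by rewrite kZ rmorphM mulrCA mulrA.
exists (fun i => blift (fun b m => b * j (k i m))); split=> [i|i b|i l|].
- exact: bliftD.
- apply: bc_ext => [x y|x y|c m].
  + by rewrite scalerDr bliftD.
  + by rewrite bliftD// mulrDr.
  + by rewrite scale_bpure !bliftE// mulrA.
- by rewrite bliftE// ke rmorph_nat mul1r.
- apply: bc_ext => // [x y|b m].
    by rewrite -big_split; apply: eq_bigr => i _; rewrite bliftD// scalerDl.
  rewrite {1}[m]kE (big_morph (bpure b) (bpureDr b) (bpure0r b)).
  apply: eq_bigr => i _.
  by rewrite bliftE// -bpureZ scale_bpure mulr1 mulrC.
Qed.

End BaseChangeModule.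

Section BaseChange.
Variables (A B : diffRing) (j : diffMorph A B).
Implicit Types M N P : dmod A.

Definition bc_nabla M : bc j M -> bc j M :=
  blift (fun b m => bpure j (der b) m + bpure j b (nabla m)).

Lemma bc_nabla_bal M :
  bbalanced j (fun b (m : M) => bpure j (der b) m + bpure j b (nabla m)).
Proof.
apply: bbalancedP => [m x y|b x y|a b m].
- by rewrite derD !bpureDl addrACA.
- by rewrite nablaD !bpureDr addrACA.
- rewrite derM -dmorph_der nablaZ !bpureDl !bpureDr !bpureZ.
  by rewrite [in RHS]addrCA addrA.
Qed.

Lemma bc_nabla_pure M b (m : M) :
  bc_nabla (bpure j b m) = bpure j (der b) m + bpure j b (nabla m).
Proof. by apply: bliftE; exact: bc_nabla_bal. Qed.

Lemma bc_nablaD M : {morph @bc_nabla M : x y / x + y}.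
Proof. by apply: bliftD; exact: bc_nabla_bal. Qed.

Lemma bc_nablaZ M (b : B) (x : bc j M) :
  bc_nabla (b *: x) = der b *: x + b *: bc_nabla x.
Proof.
move: x; apply: bc_ext => [x y|x y|c m].
- by rewrite scalerDr bc_nablaD.
- by rewrite bc_nablaD !scalerDr addrACA.
- rewrite bc_nabla_pure scalerDr !scale_bpure bc_nabla_pure derM bpureDl.
  by rewrite addrA.
Qed.

Definition dbc M : dmod B := Dmod (@bc_nablaD M) (@bc_nablaZ M).

Definition blift_hom M (P : dmod B) (f : B -> M -> P) (bf : bbalanced j f)
    (fZ : forall b c m, f (b * c) m = b *: f c m)
    (fN : forall b m, f (der b) m + f b (nabla m) = nabla (f b m)) :
  dhom (dbc M) P.
Proof.
apply: (@Dhom B (dbc M) P (blift f) (blift_linear bf fZ)).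
apply: bc_ext => [x y|x y|b m]; rewrite /= ?bc_nablaD ?bliftD ?nablaD//.
by rewrite bc_nabla_pure bliftD// !bliftE.
Defined.

Lemma blift_homE M (P : dmod B) (f : B -> M -> P) bf fZ fN b m :
  @blift_hom M P f bf fZ fN (bpure j b m) = f b m.
Proof. exact: bliftE. Qed.

Lemma dbc_ext M (P : dmod B) (f g : dhom (dbc M) P) :
  (forall b m, f (bpure j b m) = g (bpure j b m)) -> f = g.
Proof.
move=> fg; apply/dhom_ext/bc_ext => //; [exact: (dhomD f) | exact: (dhomD g)].
Qed.

Definition dbcm M N (f : dhom M N) : dhom (dbc M) (dbc N).
Proof.
apply: (@blift_hom M (dbc N) (fun b m => bpure j b (f m))).
- apply: bbalancedP => [m x y|b x y|a b m].
  + by rewrite bpureDl.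
  + by rewrite dhomD bpureDr.
  + by rewrite bpureZ dhomZ.
- by move=> b c m; rewrite scale_bpure.
- by move=> b m; rewrite /= bc_nabla_pure dfun_nabla.
Defined.

Lemma dbcmE M N (f : dhom M N) b m :
  dbcm f (bpure j b m) = bpure j b (f m).
Proof. exact: blift_homE. Qed.

Definition dbc_functor : functor (dmod_tensor A) (dmod_tensor B).
Proof.
apply: (@Functor (dmod_tensor A) (dmod_tensor B) dbc dbcm).
- by move=> M; apply: dbc_ext => b m; rewrite dbcmE.
- by move=> M N P g f; apply: dbc_ext => b m; rewrite tcE !dbcmE.
Defined.

Section Multiplication.
Variables M N : dmod A.

(* (b (x) m) (x) (c (x) n) |-> bc (x) (m (x) n) *)
Definition mul_in (b : B) (m : M) (y : dbc N) : dbc (dtens M N) :=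
  blift (fun c n => bpure j (b * c) (m %(x) n)) y.
Definition mul_fun (x : dbc M) (y : dbc N) : dbc (dtens M N) :=
  blift (fun b m => mul_in b m y) x.

Lemma mul_in_bal b m :
  bbalanced j (fun c (n : N) => bpure j (b * c) ((m %(x) n) : dtens M N)).
Proof.
apply: bbalancedP => [n x y|c x y|a c n].
- by rewrite mulrDr bpureDl.
- by rewrite pureDr bpureDr.
- by rewrite mulrCA bpureZ scale_pure pureZ.
Qed.

Lemma mul_inE b m c n :
  mul_in b m (bpure j c n) = bpure j (b * c) ((m %(x) n) : dtens M N).
Proof. by apply: bliftE; exact: mul_in_bal. Qed.

Lemma mul_inD b m : {morph mul_in b m : x y / x + y}.
Proof. by apply: bliftD; exact: mul_in_bal. Qed.

Lemma mul_in_bal2 y : bbalanced j (fun b m => mul_in b m y).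
Proof.
apply: bbalancedP => [m b c|b m m'|a b m]; move: y;
  apply: bc_ext => [x y|x y|c' n].
- by rewrite mul_inD.
- by rewrite !mul_inD addrACA.
- by rewrite !mul_inE mulrDl bpureDl.
- by rewrite mul_inD.
- by rewrite !mul_inD addrACA.
- by rewrite !mul_inE pureDl bpureDr.
- by rewrite mul_inD.
- by rewrite mul_inD.
- by rewrite !mul_inE -mulrA bpureZ scale_pure.
Qed.

Lemma mul_funDl y : {morph mul_fun^~ y : x x' / x + x'}.
Proof. by apply: bliftD; exact: mul_in_bal2. Qed.

Lemma mul_fun_pure b m y : mul_fun (bpure j b m) y = mul_in b m y.
Proof. by apply: bliftE; exact: mul_in_bal2. Qed.

Lemma mul_funDr x : {morph mul_fun x : y y' / y + y'}.
Proof.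
move=> y y'; move: x; apply: bc_ext => [x x'|x x'|b m].
- exact: mul_funDl.
- by rewrite !mul_funDl addrACA.
- by rewrite !mul_fun_pure mul_inD.
Qed.

Lemma mul_funE b m c n :
  mul_fun (bpure j b m) (bpure j c n) = bpure j (b * c) ((m %(x) n) : dtens M N).
Proof. by rewrite mul_fun_pure mul_inE. Qed.

Lemma bc_ext_bi (P : zmodType) (f g : dbc M -> dbc N -> P) :
  (forall y, {morph f^~ y : x x' / x + x'}) ->
  (forall x, {morph f x : y y' / y + y'}) ->
  (forall y, {morph g^~ y : x x' / x + x'}) ->
  (forall x, {morph g x : y y' / y + y'}) ->
  (forall b m c n, f (bpure j b m) (bpure j c n) = g (bpure j b m) (bpure j c n)) ->
  forall x y, f x y = g x y.
Proof.
move=> f1 f2 g1 g2 fg x y; move: x.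
apply: bc_ext => [||b m]; [exact: f1 | exact: g1 |].
by move: y; apply: bc_ext => [||c n]; [exact: f2 | exact: g2 |].
Qed.

Lemma mul_funZ (a : B) x y : mul_fun (a *: x) y = a *: mul_fun x y.
Proof.
move: x y; apply: bc_ext_bi => [y x x'|x y y'|y x x'|x y y'|b m c n].
- by rewrite scalerDr mul_funDl.
- by rewrite mul_funDr.
- by rewrite mul_funDl scalerDr.
- by rewrite mul_funDr scalerDr.
- by rewrite [_ *: bpure _ _ _]scale_bpure !mul_funE scale_bpure mulrA.
Qed.

Definition dbc_mul : dhom (dtens (dbc M) (dbc N)) (dbc (dtens M N)).
Proof.
apply: (@tlift_hom B (dbc M) (dbc N) (dbc (dtens M N)) mul_fun).
- split=> [y|x|a]; [exact: mul_funDl | exact: mul_funDr |].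
  move=> x y; rewrite mul_funZ; move: x y.
  apply: bc_ext_bi => [y x x'|x y y'|y x x'|x y y'|b m c n].
  + by rewrite mul_funDl scalerDr.
  + by rewrite mul_funDr scalerDr.
  + by rewrite mul_funDl.
  + by rewrite scalerDr mul_funDr.
  + by rewrite [in RHS]scale_bpure !mul_funE scale_bpure mulrCA.
- exact: mul_funZ.
- apply: bc_ext_bi => [y x x'|x y y'|y x x'|x y y'|b m c n].
  + by rewrite nablaD !mul_funDl addrACA.
  + by rewrite nablaD !mul_funDr addrACA.
  + by rewrite mul_funDl nablaD.
  + by rewrite mul_funDr nablaD.
  + rewrite mul_funE /= !bc_nabla_pure mul_funDl mul_funDr !mul_funE /=.
    by rewrite tnabla_pure derM bpureDl bpureDr addrACA.
Defined.

Lemma dbc_mulE b m c n :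
  dbc_mul ((bpure j b m : dbc M) %(x) (bpure j c n : dbc N)) =
  bpure j (b * c) ((m %(x) n) : dtens M N).
Proof. by rewrite /dbc_mul tlift_homE mul_funE. Qed.

Definition mul_inv_fun (t : tensor M N) : dtens (dbc M) (dbc N) :=
  tlift (fun m n => (bpure j 1 m : dbc M) %(x) (bpure j 1 n : dbc N)) t.

Lemma mul_inv_bal : balanced (fun (m : M) (n : N) =>
  (bpure j 1 m : dbc M) %(x) (bpure j 1 n : dbc N)).
Proof.
split=> [n x y|m x y|a m n].
- by rewrite bpureDr pureDl.
- by rewrite bpureDr pureDr.
- rewrite -!bpureZ -[bpure j (_ * _) m]scale_bpure -[bpure j (_ * _) n]scale_bpure.
  exact: pureZ.
Qed.

Lemma mul_invD : {morph mul_inv_fun : x y / x + y}.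
Proof. exact/tliftD/mul_inv_bal. Qed.
Lemma mul_invE m n :
  mul_inv_fun (m %(x) n) = (bpure j 1 m : dbc M) %(x) (bpure j 1 n : dbc N).
Proof. exact/tlift_pure/mul_inv_bal. Qed.

Definition dbc_mul_inv : dhom (dbc (dtens M N)) (dtens (dbc M) (dbc N)).
Proof.
apply: (@blift_hom (dtens M N) (dtens (dbc M) (dbc N))
          (fun b t => b *: mul_inv_fun t)).
- apply: bbalancedP => [t x y|b x y|a b t].
  + by rewrite scalerDl.
  + by rewrite mul_invD scalerDr.
  + rewrite mulrC -scalerA; congr (_ *: _); move: t.
    apply: tensor_ext => [x y|x y|m n].
    * by rewrite mul_invD scalerDr.
    * by rewrite scalerDr mul_invD.
    * by rewrite scale_pure !mul_invE scale_pure scale_bpure mulr1 -bpureZ mulr1.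
- by move=> b c m; rewrite scalerA.
- move=> b t; rewrite nablaZ; congr (_ + _ *: _); move: t.
  apply: tensor_ext => [x y|x y|m n].
  + by rewrite nablaD mul_invD.
  + by rewrite mul_invD nablaD.
  + rewrite /= tnabla_pure mul_invD !mul_invE tnabla_pure /= !bc_nabla_pure der1.
    by rewrite !bpure0l !add0r.
Defined.

Lemma dbc_mul_invE b m n :
  dbc_mul_inv (bpure j b ((m %(x) n) : dtens M N)) =
  b *: ((bpure j 1 m : dbc M) %(x) (bpure j 1 n : dbc N)).
Proof. rewrite /dbc_mul_inv blift_homE; congr (_ *: _); exact/tlift_pure/mul_inv_bal. Qed.

End Multiplication.

Definition dbc_one : dhom (dunit B) (dbc (dunit A)).
Proof.
apply: (@Dhom B (dunit B) (dbc (dunit A))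
          (fun b => bpure j b (1 : dunit A))).
- by apply: lin_mk => [x y|a x]; rewrite ?bpureDl ?scale_bpure.
- by move=> b; rewrite /= bc_nabla_pure /= der1 bpure0r addr0.
Defined.

Definition dbc_one_inv : dhom (dbc (dunit A)) (dunit B).
Proof.
apply: (@blift_hom (dunit A) (dunit B) (fun b (a : A) => b * j a)).
- apply: bbalancedP => [m x y|b x y|a b c].
  + by rewrite mulrDl.
  + by rewrite rmorphD mulrDr.
  + by rewrite [in RHS]rmorphM mulrCA mulrA.
- by move=> b c a; rewrite -mulrA.
- by move=> b a; rewrite /= derM dmorph_der.
Defined.

Lemma dbc_one_invE b a : dbc_one_inv (bpure j b (a : dunit A)) = b * j a.
Proof. exact: blift_homE. Qed.

Lemma dbc_oneE b : dbc_one b = bpure j b (1 : dunit A).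
Proof. by []. Qed.

Definition bcE := (tcE, dbcmE, dbc_mulE, dbc_mul_invE, dbc_one_invE, dbc_oneE).

Lemma dbc_ext2 M N (P : dmod B) (f g : dhom (dtens (dbc M) (dbc N)) P) :
  (forall b m c n,
     f ((bpure j b m : dbc M) %(x) (bpure j c n : dbc N)) =
     g ((bpure j b m : dbc M) %(x) (bpure j c n : dbc N))) -> f = g.
Proof.
move=> fg; apply: dhom_ext2; apply: bc_ext_bi => // [y|x|y|x];
  by move=> ? ?; rewrite ?pureDl ?pureDr dhomD.
Qed.

Lemma dbc_ext3 M N P (Q : dmod B)
    (f g : dhom (dtens (dtens (dbc M) (dbc N)) (dbc P)) Q) :
  (forall b m c n d p,
     f (((bpure j b m : dbc M) %(x) (bpure j c n : dbc N)
           : dtens (dbc M) (dbc N)) %(x) (bpure j d p : dbc P)) =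
     g (((bpure j b m : dbc M) %(x) (bpure j c n : dbc N)
           : dtens (dbc M) (dbc N)) %(x) (bpure j d p : dbc P))) -> f = g.
Proof.
move=> fg; apply: dhom_ext3 => x y z; move: x y.
apply: bc_ext_bi => [y|x|y|x|b m c n];
  try by move=> ? ?; rewrite ?pureDl ?pureDr ?pureDl dhomD.
move: z; apply: bc_ext => // ? ?; by rewrite pureDr dhomD.
Qed.

Definition dbc_tensor : tensorFunctor (dmod_tensor A) (dmod_tensor B).
Proof.
apply: (@TensorFunctor (dmod_tensor A) (dmod_tensor B) dbc_functor
          dbc_mul dbc_one).
- move=> M N; exists (dbc_mul_inv M N); split.
    apply: dbc_ext2 => b m c n; rewrite !bcE.
    rewrite -[in RHS](mulr1 b) -[in RHS](mulr1 c) -![in RHS]scale_bpure.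
    by rewrite -pureZ -!scale_pure scalerA mulrC.
  apply: dbc_ext => b t; move: t; apply: tensor_ext => [x y|x y|m n].
  + by rewrite bpureDr dhomD.
  + by rewrite bpureDr dhomD.
  + by rewrite !bcE dhomZ dbc_mulE scale_bpure !mulr1.
- exists dbc_one_inv; split.
    by apply: dhom_ext => b; rewrite !bcE rmorph1 mulr1.
  apply: dbc_ext => b a; rewrite !bcE mulrC bpureZ.
  by rewrite /GRing.scale/= mulr1.
- by move=> M M' N N' f g; apply: dbc_ext2 => b m c n; rewrite !bcE.
- by move=> M N P; apply: dbc_ext3 => b m c n d p; rewrite !bcE mulrA.
- move=> M; apply: dhom_ext2 => b x; move: x.
  apply: bc_ext => [x y|x y|c m].
  + by rewrite pureDr dhomD.
  + by rewrite pureDr dhomD.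
  + by rewrite !bcE scale1r scale_bpure.
- move=> M; apply: dhom_ext2 => x b; move: x.
  apply: bc_ext => [x y|x y|c m].
  + by rewrite pureDl dhomD.
  + by rewrite pureDl dhomD.
  + by rewrite !bcE scale1r scale_bpure mulrC.
- by move=> M N; apply: dbc_ext2 => b m c n; rewrite !bcE mulrC.
Defined.

Lemma dbc_free (M : dmod_tensor A) : dmod_free M -> dmod_free (dbc_tensor M).
Proof. exact: finite_free_bc. Qed.

Definition base_change : tensorFunctor (MIC A) (MIC B) :=
  full_tensor_functor (dmod_free_stable A) (dmod_free_stable B) dbc_free.

End BaseChange.
(* The series sum_n (a n) z^n. *)
Definition fps (F : comNzRingType) : Type := nat -> F.

Section FormalPowerSeries.
Variable F : comNzRingType.
Implicit Types a b c : fps F.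

HB.instance Definition _ := GRing.Zmodule.copy (fps F) (nat -> F).

Definition fps_mul a b : fps F := fun n => \sum_(i < n.+1) a i * b (n - i)%N.
Definition fps_one : fps F := fun n => (n == 0%N)%:R.

Let trunc m a : {poly F} := \poly_(i < m.+1) a i.

Lemma trunc_coef m a n : (n <= m)%N -> (trunc m a)`_n = a n.
Proof. by move=> nm; rewrite coef_poly ltnS nm. Qed.

Lemma fps_mul_trunc m a b n : (n <= m)%N ->
  fps_mul a b n = (trunc m a * trunc m b)`_n.
Proof.
move=> nm; rewrite coefM; apply: eq_bigr => i _.
have im : (i <= m)%N by rewrite (leq_trans _ nm)// -ltnS.
by rewrite !trunc_coef// (leq_trans (leq_subr _ _)).
Qed.

Lemma fps_mulC : commutative fps_mul.
Proof.
by move=> a b; apply/funext => n; rewrite !(@fps_mul_trunc n)// mulrC.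
Qed.

Lemma fps_mulA : associative fps_mul.
Proof.
move=> a b c; apply/funext => n.
transitivity ((trunc n a * trunc n b * trunc n c)`_n).
  rewrite -mulrA coefM; apply: eq_bigr => i _.
  rewrite trunc_coef -1?ltnS//; congr (_ * _).
  by apply: fps_mul_trunc; exact: leq_subr.
rewrite coefM; apply: eq_bigr => i _.
rewrite trunc_coef ?leq_subr//; congr (_ * _).
by rewrite -fps_mul_trunc// -ltnS.
Qed.

Lemma fps_mul1 : left_id fps_one fps_mul.
Proof.
move=> a; apply/funext => n; rewrite /fps_mul big_ord_recl /fps_one eqxx mul1r.
by rewrite subn0 big1 ?addr0// => i _; rewrite mul0r.
Qed.

Lemma fps_mulDl : left_distributive fps_mul +%R.
Proof.
move=> a b c; apply/funext => n; rewrite /fps_mul -[RHS]big_split.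
by apply: eq_bigr => i _; exact: mulrDl.
Qed.

Lemma fps_one_neq0 : fps_one != 0 :> fps F.
Proof. by apply/eqP => /(congr1 (@^~ 0%N)) /eqP; rewrite /fps_one oner_eq0. Qed.

HB.instance Definition _ := GRing.Zmodule_isComNzRing.Build (fps F)
  fps_mulA fps_mulC fps_mul1 fps_mulDl fps_one_neq0.

Lemma fpsME a b n : (a * b) n = \sum_(i < n.+1) a i * b (n - i)%N.
Proof. by []. Qed.

(* z d/dz *)
Definition fps_theta a : fps F := fun n => n%:R * a n.

Lemma fps_thetaD : {morph fps_theta : a b / a + b}.
Proof. by move=> a b; apply/funext => n; exact: mulrDr. Qed.

Lemma fps_thetaM a b :
  fps_theta (a * b) = fps_theta a * b + a * fps_theta b.
Proof.
apply/funext => n; rewrite /fps_theta fpsME mulr_sumr -[RHS]big_split.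
apply: eq_bigr => i _ /=; rewrite -[X in X%:R * _](@subnKC i n) -1?ltnS//.
by rewrite natrD mulrDl mulrA mulrCA.
Qed.

Definition fps_const (x : F) : fps F := fun n => if n == 0%N then x else 0.
Definition fps_z : fps F := fun n => (n == 1%N)%:R.

Lemma fps_const_zmod : zmod_morphism fps_const.
Proof.
move=> x y; apply/funext => n; rewrite /fps_const.
by change ((if n == 0%N then x - y else 0) =
  (if n == 0%N then x else 0) - (if n == 0%N then y else 0));
  case: ifP => // _; rewrite subr0.
Qed.

Lemma fps_constM : monoid_morphism fps_const.
Proof.
split=> [|x y]; apply/funext => n; first by
  change ((if n == 0%N then 1 else 0) = (n == 0%N)%:R :> F); case: eqP.
rewrite fpsME big_ord_recl big1 ?addr0 => [|i _].
  by rewrite /fps_const eqxx subn0; case: eqP => // _; rewrite mulr0.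
by rewrite /fps_const /= mul0r.
Qed.

HB.instance Definition _ :=
  GRing.isZmodMorphism.Build F (fps F) fps_const fps_const_zmod.
HB.instance Definition _ :=
  GRing.isMonoidMorphism.Build F (fps F) fps_const fps_constM.

Lemma fps_theta_const x : fps_theta (fps_const x) = 0.
Proof.
apply/funext => n; rewrite /fps_theta /fps_const.
by case: eqP => [->|_]; rewrite ?mul0r ?mulr0.
Qed.

Lemma fps_theta_z : fps_theta fps_z = fps_z.
Proof.
apply/funext => n; rewrite /fps_theta /fps_z.
by case: eqP => [->|_]; rewrite ?mul1r ?mulr0.
Qed.

End FormalPowerSeries.

Record absval (R : realType) (F : fieldType) := Absval {
  av :> F -> R;
  av_ge0 : forall x, 0 <= av x;
  av_eq0 : forall x, (av x == 0) = (x == 0);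
  avM : {morph av : x y / x * y};
  av_ultra : forall x y, av (x + y) <= Num.max (av x) (av y) }.

Section Convergence.
Variables (R : realType) (F : fieldType) (v : absval R F).

(* As in non-archimedean analysis, a series with coefficients a converges at  *)
(* radius r when |a n| r^n tends to 0.                                        *)
Definition radius (a : nat -> F) : \bar R :=
  ereal_sup [set r%:E | r in
    [set r : R | 0 <= r /\ (fun n => v (a n) * r ^+ n) @ \oo --> (0 : R)]].

Lemma av0 : v 0 = 0. Proof. by apply/eqP; rewrite av_eq0. Qed.
Lemma av1 : v 1 = 1.
Proof.
have h : v 1 != 0 by rewrite av_eq0 oner_eq0.
by apply: (mulfI h); rewrite -avM !mulr1.
Qed.
Lemma avN x : v (- x) = v x.
Proof.
have h : v (-1) = 1.
  apply/eqP; rewrite -(@eqrXn2 _ 2)// ?av_ge0//.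
  by rewrite expr2 -avM mulrNN mulr1 av1 expr1n.
by rewrite -mulN1r avM h mul1r.
Qed.
Lemma av_nat n : v n%:R <= 1.
Proof.
elim: n => [|n IH]; first by rewrite av0.
by rewrite -natr1 (le_trans (av_ultra _ _ _))// ge_max IH av1 lexx.
Qed.

Lemma av_sum n (f : nat -> F) (C : R) : 0 <= C ->
  (forall i, (i < n)%N -> v (f i) <= C) -> v (\sum_(i < n) f i) <= C.
Proof.
move=> C0; elim: n => [|n IH] fC; first by rewrite big_ord0 av0.
rewrite big_ord_recr (le_trans (av_ultra _ _ _))// ge_max fC// andbT.
by apply: IH => i /ltnW; exact: fC.
Qed.

Lemma radius_gt0P (a : nat -> F) :
  (0 < radius a)%E <->
  exists r C : R, 0 < r /\ forall n, v (a n) * r ^+ n <= C.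
Proof.
split.
  move=> /ereal_sup_gt[_ [r [r0 cr] <-]]; rewrite lte_fin => rp.
  have /cvgP/cvg_seq_bounded/pinfty_ex_gt0[C _ /= hC] := cr.
  exists r, C; split => // n; apply: le_trans (hC n I).
  exact: ler_norm.
move=> [r [C [r0 hC]]].
have r20 : 0 < r / 2 by rewrite divr_gt0.
apply: (@lt_le_trans _ _ (r / 2)%:E); first by rewrite lte_fin.
apply: ereal_sup_ubound; exists (r / 2) => //; split; first exact: ltW.
apply: (@squeeze_cvgr _ _ _ _ (fun=> 0) (fun n => C * 2^-1 ^+ n)).
- near=> n; apply/andP; split; first by rewrite mulr_ge0 ?av_ge0// exprn_ge0// ltW.
  rewrite expr_div_n mulrA -exprVn ler_wpM2r// exprn_ge0// invr_ge0//.
- exact: cvg_cst.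
- rewrite -(mulr0 C); apply: cvgM; first exact: cvg_cst.
  by apply: cvg_expr; rewrite gtr0_norm ?invr_gt0// invf_lt1// ltr1n.
Unshelve. all: by end_near. Qed.

Lemma radius_gt0_pair (a b : nat -> F) :
  (0 < radius a)%E -> (0 < radius b)%E ->
  exists r C : R, [/\ 0 < r, 0 <= C, forall n, v (a n) * r ^+ n <= C &
                      forall n, v (b n) * r ^+ n <= C].
Proof.
move=> /radius_gt0P[r [C [r0 hC]]] /radius_gt0P[s [D [s0 hD]]].
have C0 : 0 <= C by apply: le_trans (hC 0%N); rewrite mulr_ge0 ?av_ge0.
exists (Num.min r s), (Num.max C D); split.
- by rewrite lt_min r0.
- by rewrite le_max C0.
- move=> n; rewrite le_max (le_trans _ (hC n))//.
  rewrite ler_wpM2l ?av_ge0// lerXn2r ?nnegrE ?le_min ?ge_min ?lexx ?(ltW r0)//.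
  by rewrite ltW.
- move=> n; rewrite le_max (le_trans _ (hD n)) ?orbT//.
  rewrite ler_wpM2l ?av_ge0// lerXn2r ?nnegrE ?le_min ?ge_min ?lexx ?orbT//.
    by rewrite !ltW.
  by rewrite ltW.
Qed.

Definition convergent : {pred fps F} := fun a => `[< (0 < radius a)%E >].

Lemma convergent_subring : subring_closed convergent.
Proof.
split.
- apply/asboolP/radius_gt0P; exists 1, 1; split=> // n.
  by rewrite expr1n mulr1 (_ : (1 : fps F) n = (n == 0%N)%:R)// av_nat.
- move=> a b /asboolP ha /asboolP hb; apply/asboolP/radius_gt0P.
  have [r [C [r0 C0 hC hD]]] := radius_gt0_pair ha hb.
  exists r, C; split=> // n; rewrite (_ : (a - b) n = a n - b n)//.
  have rn : 0 <= r ^+ n by rewrite exprn_ge0// ltW.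
  have := av_ultra v (a n) (- b n); rewrite avN le_max => /orP[] h.
    by rewrite (le_trans _ (hC n))// ler_wpM2r.
  by rewrite (le_trans _ (hD n))// ler_wpM2r.
- move=> a b /asboolP ha /asboolP hb; apply/asboolP/radius_gt0P.
  have [r [C [r0 C0 hC hD]]] := radius_gt0_pair ha hb.
  exists r, (C * C); split=> // n; rewrite fpsME.
  have rn : 0 < r ^+ n by rewrite exprn_gt0.
  rewrite -ler_pdivlMr//; apply: (@av_sum _ (fun i => a i * b (n - i)%N)).
    by rewrite divr_ge0 ?mulr_ge0// ltW.
  move=> i iltn; rewrite ler_pdivlMr// avM -[in r ^+ n](@subnK i n)//.
  rewrite exprD [r ^+ _ * _]mulrC mulrACA.
  by rewrite ler_pM// mulr_ge0 ?av_ge0// exprn_ge0// ltW.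
Qed.

HB.instance Definition _ :=
  GRing.isSubringClosed.Build (fps F) convergent convergent_subring.

Lemma convergent_theta (a : fps F) :
  a \in convergent -> fps_theta a \in convergent.
Proof.
move=> /asboolP/radius_gt0P[r [C [r0 hC]]]; apply/asboolP/radius_gt0P.
exists r, C; split=> // n; apply: le_trans (hC n).
rewrite /fps_theta avM ler_wpM2r//; first by rewrite exprn_ge0// ltW.
by rewrite ler_piMl ?av_ge0// av_nat.
Qed.

Lemma convergent_bounded (a : fps F) C :
  (forall n, v (a n) <= C) -> a \in convergent.
Proof.
move=> aC; apply/asboolP/radius_gt0P.
by exists 1, C; split=> // n; rewrite expr1n mulr1.
Qed.

Lemma convergent_const x : fps_const x \in convergent.
Proof.
apply: (@convergent_bounded _ (v x)) => n; rewrite /fps_const.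
by case: ifP => // _; rewrite av0 av_ge0.
Qed.

Lemma convergent_z : fps_z F \in convergent.
Proof. by apply: (@convergent_bounded _ 1) => n; exact: av_nat. Qed.

Record cps := Cps { cps_val :> fps F; cps_valP : cps_val \in convergent }.

HB.instance Definition _ := [isSub for cps_val].
HB.instance Definition _ := [Choice of cps by <:].
HB.instance Definition _ := [SubChoice_isSubComNzRing of cps by <:].

Definition type_coef (lambda : F) : nat -> F :=
  fun m => if lambda == m%:R then 0 else (lambda - m%:R)^-1.

Definition ptype (lambda : F) : \bar R := radius (type_coef lambda).

End Convergence.

(* A differential ring A with constants from E, a parameter z and the         *)
(* derivation z d/dz.                                                         *)
Record zRing (E : fieldType) := ZRing {
  zr_ring :> diffRing;
  zr_const : {rmorphism E -> zr_ring};
  zr_z : zr_ring;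
  zr_der_const : forall c, der (zr_const c) = 0;
  zr_der_z : der zr_z = zr_z }.

Arguments zr_z {E} z.

Definition fps_diffRing (E : fieldType) : diffRing :=
  DiffRing (@fps_thetaD E) (@fps_thetaM E).

Definition Ohat (E : fieldType) : zRing E :=
  @ZRing E (fps_diffRing E) (@fps_const E) (fps_z E)
    (@fps_theta_const E) (@fps_theta_z E).

Section Odagger.
Variables (R : realType) (E : fieldType) (v : absval R E).

Definition cps_theta (a : cps v) : cps v := Cps (convergent_theta (cps_valP a)).

Lemma cps_thetaD : {morph cps_theta : a b / a + b}.
Proof. by move=> a b; apply: val_inj; exact: fps_thetaD. Qed.
Lemma cps_thetaM a b :
  cps_theta (a * b) = cps_theta a * b + a * cps_theta b.
Proof. by apply: val_inj; exact: fps_thetaM. Qed.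

Definition cps_diffRing : diffRing := DiffRing cps_thetaD cps_thetaM.

Definition cps_const (x : E) : cps v := Cps (convergent_const v x).

Lemma cps_const_zmod : zmod_morphism cps_const.
Proof. by move=> x y; apply: val_inj; exact: fps_const_zmod. Qed.
Lemma cps_constM : monoid_morphism cps_const.
Proof.
by split=> [|x y]; apply: val_inj; [exact: (fps_constM E).1
  | exact: (fps_constM E).2].
Qed.
HB.instance Definition _ :=
  GRing.isZmodMorphism.Build E (cps v) cps_const cps_const_zmod.
HB.instance Definition _ :=
  GRing.isMonoidMorphism.Build E (cps v) cps_const cps_constM.

Definition cps_z : cps v := Cps (convergent_z v).

Lemma cps_theta_const x : cps_theta (cps_const x) = 0.
Proof. by apply: val_inj; exact: fps_theta_const. Qed.
Lemma cps_theta_z : cps_theta cps_z = cps_z.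
Proof. by apply: val_inj; exact: fps_theta_z. Qed.

Definition Odagger : zRing E :=
  @ZRing E cps_diffRing cps_const cps_z cps_theta_const cps_theta_z.

Definition Odagger_to_Ohat : diffMorph Odagger (Ohat E) :=
  @DiffMorph Odagger (Ohat E) (val : {rmorphism cps v -> fps E})
    (fun=> erefl).

End Odagger.

Section Fibre.
Variables (E : fieldType) (Z : zRing E) (M : dmod Z).

(* Additivity and the Leibniz rule already make nabla E-linear. *)
Lemma nabla_Elinear (c : E) (x : M) :
  nabla (zr_const Z c *: x) = zr_const Z c *: nabla x.
Proof. by rewrite nablaZ zr_der_const scale0r add0r. Qed.

Definition zM : {pred M} := fun x => `[< exists y, x = zr_z Z *: y >].

Lemma zM_closed : zmod_closed zM.
Proof.
split; first by apply/asboolP; exists 0; rewrite scaler0.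
move=> _ _ /asboolP[x ->] /asboolP[y ->]; apply/asboolP.
by exists (x - y); rewrite scalerBr.
Qed.
HB.instance Definition _ := GRing.isZmodClosed.Build M zM zM_closed.

Definition fibre : Type := Quotient.quot zM.
HB.instance Definition _ := GRing.Zmodule.on fibre.
HB.instance Definition _ := EqQuotient.on fibre.

Definition fib (x : M) : fibre := \pi_fibre x.

Lemma fibP x y : reflect (exists t, x - y = zr_z Z *: t) (fib x == fib y).
Proof.
by rewrite -(@Quotient.idealrBE M zM); exact: asboolP.
Qed.

Lemma fib_repr (x : M) : exists t, repr (fib x) - x = zr_z Z *: t.
Proof. by apply/fibP; rewrite /fib reprK. Qed.

Lemma fibD x y : fib (x + y) = fib x + fib y.
Proof. exact: raddfD. Qed.

Lemma fib_ind (P : fibre -> Prop) : (forall x, P (fib x)) -> forall x, P x.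
Proof. by move=> h x; rewrite -[x]reprK; exact: h. Qed.

Definition fib_scale (c : E) (x : fibre) : fibre := fib (zr_const Z c *: repr x).
Definition fib_nabla (x : fibre) : fibre := fib (nabla (repr x)).

Lemma fib_scaleE c x : fib_scale c (fib x) = fib (zr_const Z c *: x).
Proof.
apply/eqP/fibP; have [t ht] := fib_repr x.
by exists (zr_const Z c *: t); rewrite -scalerBr ht !scalerA mulrC.
Qed.

Lemma fib_nablaE x : fib_nabla (fib x) = fib (nabla x).
Proof.
apply/eqP/fibP; have [t ht] := fib_repr x; exists (t + nabla t).
have nB : nabla (repr (fib x)) = nabla (zr_z Z *: t) + nabla x.
  by rewrite -nablaD -ht subrK.
by rewrite nB addrK nablaZ zr_der_z scalerDr.
Qed.

Lemma fib_scaleA a b x : fib_scale a (fib_scale b x) = fib_scale (a * b) x.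
Proof. by elim/fib_ind: x => x; rewrite !fib_scaleE scalerA rmorphM. Qed.
Lemma fib_scale1 : left_id 1 fib_scale.
Proof. by elim/fib_ind => x; rewrite fib_scaleE rmorph1 scale1r. Qed.
Lemma fib_scaleDr : right_distributive fib_scale +%R.
Proof.
move=> a; elim/fib_ind => x; elim/fib_ind => y.
by rewrite -fibD !fib_scaleE scalerDr fibD.
Qed.
Lemma fib_scaleDl x : {morph fib_scale^~ x : a b / a + b}.
Proof.
by move=> a b; elim/fib_ind: x => x; rewrite !fib_scaleE rmorphD scalerDl fibD.
Qed.
HB.instance Definition _ := GRing.Zmodule_isLmodule.Build E fibre
  fib_scaleA fib_scale1 fib_scaleDr fib_scaleDl.

Lemma fib_nablaD : {morph fib_nabla : x y / x + y}.
Proof.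
elim/fib_ind => x; elim/fib_ind => y.
by rewrite -fibD !fib_nablaE nablaD fibD.
Qed.

Lemma fib_nablaZ (c : E) x : fib_nabla (c *: x) = c *: fib_nabla x.
Proof.
elim/fib_ind: x => x; rewrite fib_nablaE.
by rewrite [_ *: fib x]fib_scaleE fib_nablaE nabla_Elinear -fib_scaleE.
Qed.

End Fibre.

(* A commutative ring with the zero derivation: differential modules over it  *)
(* are modules with a linear endomorphism.                                    *)
Lemma zero_derD (F : comNzRingType) : {morph (fun=> 0 : F) : x y / x + y : F}.
Proof. by move=> x y; rewrite addr0. Qed.
Lemma zero_derM (F : comNzRingType) (x y : F) : 0 = 0 * y + x * 0 :> F.
Proof. by rewrite mul0r mulr0 addr0. Qed.
Definition const_ring (F : comNzRingType) : diffRing :=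
  DiffRing (@zero_derD F) (@zero_derM F).

Definition const_morph (E F : comNzRingType) (iota : {rmorphism E -> F}) :
    diffMorph (const_ring E) (const_ring F) :=
  @DiffMorph (const_ring E) (const_ring F) iota (fun=> rmorph0 iota).

Section Exponents.
Variables (E F : fieldType) (iota : {rmorphism E -> F}) (Z : zRing E).

Lemma fib_leibniz (M : dmod Z) (c : const_ring E) (x : fibre M) :
  fib_nabla (c *: x) = (der c : E) *: x + c *: fib_nabla x.
Proof. by rewrite fib_nablaZ scale0r add0r. Qed.

Definition fibre_endo (M : dmod Z) : dmod (const_ring E) :=
  @Dmod (const_ring E) (fibre M) (@fib_nabla E Z M) (@fib_nablaD E Z M)
    (@fib_leibniz M).

(* lambda in F is an eigenvalue of the induced endomorphism of M / zM, i.e.   *)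
(* of its F-linear extension to F (x)_E (M / zM).                             *)
Definition exponent (M : dmod Z) (lambda : F) : Prop :=
  exists x : dbc (const_morph iota) (fibre_endo M),
    x <> 0 /\ nabla x = (lambda : const_ring F) *: x.

Definition exponents_in (S : set F) (M : MIC Z) : Prop :=
  forall lambda, exponent (sval M : dmod Z) lambda -> S lambda.

End Exponents.

(* Main.v *)
Require Import Defs.
From HB Require Import structures.
From mathcomp Require Import all_boot all_order all_algebra.
From mathcomp Require Import all_classical all_reals.
From mathcomp Require Import ring.

Set Implicit Arguments.
Unset Strict Implicit.
Unset Printing Implicit Defensive.

Import Order.TTheory GRing.Theory Num.Theory.
Local Open Scope ring_scope.

(* Essential surjectivity: if N exceeds every integer eigenvalue of ad A_0,   *)
(* a connection z d/dz + A over E[[z]] is gauge equivalent, by a unique       *)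
(* P = 1 mod z^N, to its truncation at z^N, whose coefficients are            *)
(* polynomials and hence convergent.                                          *)
(*   Fullness: the matrix X of a horizontal map satisfies                     *)
(* k X_k - (X_k A_0 - B_0 X_k) = sum_(0 < i <= k) (X_(k-i) A_i - B_i X_(k-i)).*)
(* By Cramer's rule, inverting the left-hand side costs at most a constant    *)
(* times prod |k - lambda|^-1, where lambda runs over the differences of      *)
(* exponents.  These lie in S, so each |k - lambda| is at least C rho^k; as   *)
(* among the k <= n at most one of them is smaller than the p-adic distance   *)
(* between integers, the product over all k <= n is still bounded below       *)
(* geometrically, and X converges.                                            *)

(** Base change is a tensor functor by construction, so what remains is that it is full, faithful
    and essentially surjective on connections with exponents in [S]. After a choice of bases a
    connection is a matrix [A] of power series acting by [theta + A], and a horizontal map from [A]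
    to [B] is a matrix with [theta X = X A - B X]. Comparing coefficients of [z^k] turns this into a
    recursion governed by [k - T_0], where [T_0] is the operator [X |-> X A_0 - B_0 X]
    ([horizontal_solution]). Its eigenvalues are differences of eigenvalues of the residues [A_0]
    and [B_0] ([sylvester_eigenvalue]), that is, of exponents ([exponent_root]), and [S] is closed
    under differences.

    Faithfulness holds because the modules are free and the convergent series embed in the formal
    ones ([dbcm_inj]). For fullness, [prod_divisor_ge] turns positive type into a geometric lower
    bound for products of small divisors, [recursion_bound] feeds it into the recursion, and
    [base_change_full] descends the resulting convergent map. For essential surjectivity,
    [gauge_truncation] replaces a formal connection by a polynomial one with the same residue, hence
    the same exponents. Finally, the residue of a tensor product is [A_0 (x) 1 + 1 (x) B_0], so its
    exponents are sums of exponents ([exponents_tensor_stable]). *)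

Section Equivalence.
Import Defs.
Variables (C D : category) (F : functor C D).

(** The quasi-inverse is chosen: [G Y] comes with an isomorphism [eps Y], and [G] sends [f] to the
    preimage of its conjugate by these. Identities in [C] are checked after applying the faithful
    [F]. *)
Lemma is_equivalence_full_faithful_esurj :
  (forall X Y (f g : hom X Y), fmap F f = fmap F g -> f = g) ->
  (forall X Y (g : hom (F X) (F Y)), exists f, fmap F f = g) ->
  (forall Y, exists X (f : hom (F X) Y), is_iso f) ->
  is_equivalence F.
Proof.
move=> faithF fullF esurjF.
pose G Y := sval (cid (esurjF Y)).
pose eps Y : hom (F (G Y)) Y := sval (cid (svalP (cid (esurjF Y)))).
have eps_iso Y : is_iso (eps Y) := svalP (cid (svalP (cid (esurjF Y)))).
pose eta Y := sval (cid (eps_iso Y)).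
have etaK Y : eta Y \oc eps Y = idm _ := (svalP (cid (eps_iso Y))).1.
have epsK Y : eps Y \oc eta Y = idm _ := (svalP (cid (eps_iso Y))).2.
pose pre X Y (g : hom (F X) (F Y)) := sval (cid (fullF X Y g)).
have preK X Y (g : hom (F X) (F Y)) : fmap F (pre X Y g) = g :=
  svalP (cid (fullF X Y g)).
pose Gm Y Z (f : hom Y Z) : hom (G Y) (G Z) := pre _ _ (eta Z \oc f \oc eps Y).
have Gm1 Y : Gm Y Y (idm Y) = idm (G Y).
  by apply: faithF; rewrite preK fmap_id compm1 etaK.
have GmM X Y Z (g : hom Y Z) (f : hom X Y) :
    Gm X Z (g \oc f) = Gm Y Z g \oc Gm X Y f.
  apply: faithF; rewrite fmap_comp !preK !compA.
  by rewrite -(compA _ (eps Y) (eta Y)) epsK compm1.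
exists (@Functor D C G Gm Gm1 GmM); split.
- exists (fun X => pre _ _ (eps (F X))); split=> [X|X Y f] /=.
    exists (pre _ _ (eta (F X))).
    by split; apply: faithF; rewrite fmap_comp !preK fmap_id.
  by apply: faithF; rewrite !fmap_comp !preK !compA epsK comp1m.
- exists eps; split=> // X Y f /=.
  by rewrite preK !compA epsK comp1m.
Qed.

End Equivalence.

(** * Bases and coordinates of free modules *)

Section Coordinates.
Variables (A : comNzRingType) (M : lmodType A).

Lemma coords_sum (I : finType) (e : I -> M) k : coords e k ->
  forall c i, k i (\sum_j c j *: e j) = c i.
Proof.
move=> [kD kZ ke _] c i.
rewrite (big_morph (k i) (kD i) (additive0 (kD i))) (bigD1 i)//= kZ ke eqxx.
by rewrite mulr1 big1 ?addr0// => j ji; rewrite kZ ke eq_sym (negbTE ji) mulr0.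
Qed.

Lemma coords_inj (I : finType) (e : I -> M) k : coords e k ->
  forall x y, (forall i, k i x = k i y) -> x = y.
Proof.
move=> [_ _ _ kE] x y xy; rewrite [x]kE [y]kE.
by apply: eq_bigr => i _; rewrite xy.
Qed.

(** Ordinal indices give access to matrices and characteristic polynomials. *)
Lemma finite_free_ord : finite_free M ->
  exists n (e : 'I_n -> M) k, coords e k.
Proof.
move=> /finite_freeP[I [e [k [kD kZ ke kE]]]].
exists #|I|, (fun i => e (enum_val i)), (fun i => k (enum_val i)).
split=> [i|i|i j|x]; [exact: kD | exact: kZ | |].
  by rewrite ke (inj_eq enum_val_inj).
by rewrite {1}[x]kE (reindex _ (onW_bij _ (@enum_val_bij I))).

Qed.

End Coordinates.

Lemma balanced_coords (A : comNzRingType) (M N : lmodType A) (I J : finType)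
    (e : I -> M) k (f : J -> N) l i j :
  coords e k -> coords f l -> balanced (fun m n => (k i m * l j n : A)).
Proof.
move=> [kD kZ _ _] [lD lZ _ _]; split=> [n x y|m x y|a m n].
- by rewrite kD mulrDl.
- by rewrite lD mulrDr.
- by rewrite kZ lZ mulrCA mulrA.
Qed.

(** Explicit coordinates, left existential by [finite_free_tensor], are needed to compute the
    residue of a tensor product. *)
Lemma coords_tensor (D : diffRing) (M N : lmodType D) (I J : finType)
    (e : I -> M) k (f : J -> N) l :
  coords e k -> coords f l ->
  coords (fun ij : I * J => e ij.1 %(x) f ij.2)
    (fun ij => tlift (fun m n => k ij.1 m * l ij.2 n)).
Proof.
move=> ck cl; have bal i j := balanced_coords i j ck cl.
have [kD kZ ke kE] := ck; have [_ _ lf lE] := cl.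
split=> [[i j]|[i j] a|[i j] [i' j']|].
- exact: tliftD.
- apply: (@linZ D (tensor M N) D^o); apply: tlift_linear => // b m n.
  by rewrite kZ -mulrA.
- by rewrite tlift_pure// ke lf -natrM mulnb.
- apply: tensor_ext => // [x y|m n].
    by rewrite -big_split; apply: eq_bigr => ij _; rewrite tliftD// scalerDl.
  have pb := @pure_balanced D M N; case: (pb) => p1 p2 _.
  rewrite {1}[m]kE (big_morph (fun m => m %(x) n) (p1 _) (balanced0l _ pb)).
  rewrite -(pair_bigA _ (fun i j =>
    tlift (fun m n => k i m * l j n) (m %(x) n) *: (e i %(x) f j))) /=.
  apply: eq_bigr => i _.
  rewrite {1}[n]lE (big_morph (fun n => _ %(x) n) (p2 _) (balanced0r _ pb)).
  apply: eq_bigr => j _.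
  by rewrite tlift_pure// -pureZ scalerA mulrC -scale_pure.
Qed.

Section CoordsBaseChange.
Variables (A B : comNzRingType) (h : {rmorphism A -> B}) (M : lmodType A).
Variables (I : finType) (e : I -> M) (k : I -> M -> A) (ck : coords e k).

Lemma bbalanced_coords i : bbalanced h (fun b m => b * h (k i m)).
Proof.
have [kD kZ _ _] := ck; apply: bbalancedP => [m x y|c x y|a c m].
- by rewrite mulrDl.
- by rewrite kD rmorphD mulrDr.
- by rewrite kZ rmorphM mulrCA mulrA.
Qed.

Definition bc_coord i : bc h M -> B := blift (fun b m => b * h (k i m)).

Lemma bc_coordE i b m : bc_coord i (bpure h b m) = b * h (k i m).
Proof. exact/bliftE/bbalanced_coords. Qed.

Lemma coords_bc : coords (fun i => bpure h 1 (e i)) bc_coord.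
Proof.
have [kD kZ ke kE] := ck.
have cD i : {morph bc_coord i : x y / x + y}.
  by apply: bliftD; exact: bbalanced_coords.
split=> // [i b|i l|].
- apply: bc_ext => [x y|x y|c m]; rewrite ?scalerDr ?cD ?mulrDr//.
  by rewrite scale_bpure !bc_coordE mulrA.
- by rewrite bc_coordE ke rmorph_nat mul1r.
- apply: bc_ext => // [x y|b m].
    by rewrite -big_split; apply: eq_bigr => i _; rewrite cD scalerDl.
  rewrite {1}[m]kE (big_morph (bpure h b) (bpureDr h b) (bpure0r h M b)).
  by apply: eq_bigr => i _; rewrite bc_coordE -bpureZ scale_bpure mulr1 mulrC.
Qed.

Lemma bpure1_inj : injective h -> injective (bpure h 1 : M -> bc h M).
Proof.
move=> h_inj x y xy; apply: (coords_inj ck) => i; apply: h_inj.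
by rewrite -[LHS]mul1r -[RHS]mul1r -!bc_coordE xy.
Qed.

Lemma bpure1_sum (J : finType) (a : J -> A) (m : J -> M) :
  bpure h 1 (\sum_j a j *: m j) = \sum_j h (a j) *: bpure h 1 (m j).
Proof.
rewrite (big_morph (bpure h 1) (bpureDr h 1) (bpure0r h M 1)).
by apply: eq_bigr => j _; rewrite -bpureZ -scale_bpure.
Qed.

End CoordsBaseChange.

(** * Connections and horizontal maps as matrices *)

Section FreeDmod.
Variables (D : diffRing) (M : dmod D) (I : finType) (e : I -> M).
Variables (k : I -> M -> D) (ck : coords e k).

Lemma nabla_coords x i :
  k i (nabla x) = der (k i x) + \sum_j k i (nabla (e j)) * k j x.
Proof.
case: (ck) => kD kZ ke kE.
have nS (r : seq I) (c : I -> D) :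
    nabla (\sum_(j <- r) c j *: e j) = \sum_(j <- r) nabla (c j *: e j).
  exact: (big_morph _ (@nablaD D M) (additive0 (@nablaD D M))).
rewrite {1}[x]kE nS (big_morph (k i) (kD i) (additive0 (kD i))).
under eq_bigr do rewrite nablaZ kD !kZ ke.
rewrite big_split /= (bigD1 i)//= eqxx mulr1 big1 ?addr0.
  by congr (_ + _); apply: eq_bigr => j _; rewrite mulrC.
by move=> j; rewrite eq_sym => /negbTE->; rewrite mulr0.
Qed.

Lemma dhom_coords (N : dmod D) (f : dhom M N) x : f x = \sum_i k i x *: f (e i).
Proof.
case: (ck) => _ _ _ kE; rewrite {1}[x]kE.
rewrite (big_morph f (dhomD f) (additive0 (dhomD f))).
by apply: eq_bigr => i _; rewrite dhomZ.
Qed.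

Lemma dhom_basis_ext (N : dmod D) (f g : dhom M N) :
  (forall i, f (e i) = g (e i)) -> f = g.
Proof.
move=> fg; apply: dhom_ext => x; rewrite !dhom_coords.
by apply: eq_bigr => i _; rewrite fg.
Qed.

Lemma dhom_of_basis (N : dmod D) (n : I -> N) :
  (forall j, nabla (n j) = \sum_i k i (nabla (e j)) *: n i) ->
  exists f : dhom M N, forall j, f (e j) = n j.
Proof.
case: (ck) => kD kZ ke kE nn; pose f x := \sum_i k i x *: n i.
have fl : linear f.
  move=> a x y; rewrite /f scaler_sumr -big_split; apply: eq_bigr => i _.
  by rewrite kD kZ scalerDl scalerA.
have fe j : f (e j) = n j.
  rewrite /f (bigD1 j)//= ke eqxx scale1r big1 ?addr0// => i /negbTE ij.
  by rewrite ke ij scale0r.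
suff fn x : f (nabla x) = nabla (f x) by exists (Dhom fl fn).
rewrite /f [RHS](big_morph _ (@nablaD D N) (additive0 (@nablaD D N))).
under [LHS]eq_bigr do rewrite nabla_coords scalerDl.
under [RHS]eq_bigr do rewrite nablaZ nn.
rewrite !big_split /=; congr (_ + _).
under eq_bigr do rewrite scaler_suml.
under [RHS]eq_bigr do rewrite scaler_sumr.
rewrite exchange_big; apply: eq_bigr => j _; apply: eq_bigr => i _.
by rewrite scalerA mulrC.
Qed.

End FreeDmod.

(* With X, A, B the matrices of f and of the two connections, this reads      *)
(* der X = X A - B X.                                                         *)
Lemma dhom_matrix (D : diffRing) (M N : dmod D) (I J : finType)
    (e : I -> M) k (f : J -> N) l (g : dhom M N) j i :
  coords e k -> coords f l ->
  der (l j (g (e i))) =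
    \sum_s l j (g (e s)) * k s (nabla (e i)) -
    \sum_t l j (nabla (f t)) * l t (g (e i)).
Proof.
move=> ck cl; apply/eqP; rewrite eq_sym subr_eq eq_sym -(nabla_coords cl).
rewrite -dfun_nabla (dhom_coords ck).
have [lD lZ _ _] := cl.
rewrite (big_morph (l j) (lD j) (additive0 (lD j))).
by apply/eqP; apply: eq_bigr => s _; rewrite lZ mulrC.
Qed.

Section MatrixHom.
Variables (D : diffRing) (M N : dmod D) (m n : nat).
Variables (e : 'I_m -> M) (k : 'I_m -> M -> D) (ck : coords e k).
Variables (f : 'I_n -> N) (l : 'I_n -> N -> D) (cl : coords f l).

(** The converse of [dhom_matrix]: solutions of the matrix equation are matrices of horizontal
    maps. *)
Lemma dhom_of_matrix (U : 'M[D]_(n, m)) :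
  map_mx (@der D) U = U *m (\matrix_(i, j) k i (nabla (e j)))
    - (\matrix_(i, j) l i (nabla (f j))) *m U ->
  exists g : dhom M N, forall j, g (e j) = \sum_i U i j *: f i.
Proof.
move=> UE; apply: (dhom_of_basis ck) => j; apply: (coords_inj cl) => i.
rewrite (nabla_coords cl) (coords_sum cl).
have /matrixP/(_ i j) := UE; rewrite !mxE => ->.
have [lD lZ _ _] := cl; rewrite (big_morph (l i) (lD i) (additive0 (lD i))).
rewrite addrAC -addrA [X in _ + X](_ : _ = 0) ?addr0.
  by apply: eq_bigr => s _; rewrite lZ (coords_sum cl) mxE mulrC.
apply/eqP; rewrite subr_eq0; apply/eqP.
by apply: eq_bigr => s _; rewrite mxE (coords_sum cl).
Qed.

Lemma dhom_comp_matrix1 (g : dhom M N) (g' : dhom N M) (U : 'M[D]_(n, m))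
    (V : 'M[D]_(m, n)) :
  (forall j, g (e j) = \sum_i U i j *: f i) ->
  (forall j, g' (f j) = \sum_i V i j *: e i) ->
  V *m U = 1%:M -> dhom_comp g' g = dhom_id M.
Proof.
move=> gE g'E VU; apply: (dhom_basis_ext ck) => j.
apply: (coords_inj ck) => i; rewrite dcompE didE gE.
rewrite (big_morph g' (dhomD g') (additive0 (dhomD g'))).
have [kD kZ ke _] := ck; rewrite (big_morph (k i) (kD i) (additive0 (kD i))) ke.
have /matrixP/(_ i j) := VU; rewrite !mxE => <-.
by apply: eq_bigr => s _; rewrite dhomZ kZ g'E (coords_sum ck) mulrC.
Qed.

End MatrixHom.

Lemma bc_nabla_bpure1 (A B : diffRing) (h : diffMorph A B) (M : dmod A) (m : M) :
  bc_nabla (bpure h 1 m) = bpure h 1 (nabla m).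
Proof. by rewrite bc_nabla_pure der1 bpure0l add0r. Qed.

(** As [N] is free and [h] injective, [N] embeds in its base change; the chosen preimages are
    therefore unique, which makes them linear and horizontal in [m]. *)
Lemma dhom_descent (A B : diffRing) (h : diffMorph A B) (M N : dmod A)
    (g : dhom (dbc h M) (dbc h N)) :
  injective h -> finite_free N ->
  (forall m, exists n, g (bpure h 1 m) = bpure h 1 n) ->
  exists f : dhom M N, dbcm h f = g.
Proof.
move=> h_inj /finite_freeP[I [e [k ck]]] /choice[f fE].
have inj := bpure1_inj ck h_inj.
have fl : linear f.
  move=> a x y; apply: inj; rewrite -fE bpureDr -bpureZ -scale_bpure.
  by rewrite (dfun_linear g) !fE bpureDr -bpureZ -scale_bpure.
have fn x : f (nabla x) = nabla (f x).
  by apply: inj; rewrite -fE -!bc_nabla_bpure1 -fE;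
    exact: (dfun_nabla g (bpure h 1 x)).
exists (Dhom fl fn); apply: dbc_ext => b m; rewrite dbcmE /=.
rewrite -[b in LHS]mulr1 -[b in RHS]mulr1 -scale_bpure -fE.
by rewrite -[bpure h (b * 1) m]scale_bpure; exact/esym/(dhomZ g).
Qed.

Lemma dbcm_inj (A B : diffRing) (h : diffMorph A B) (M N : dmod A) :
  injective h -> finite_free N -> injective (@dbcm A B h M N).
Proof.
move=> h_inj /finite_freeP[I [e [k ck]]] f g fg; apply: dhom_ext => m.
by apply: (bpure1_inj ck h_inj); rewrite -!dbcmE fg.
Qed.

Section MatrixDmod.
Variables (D : diffRing) (n : nat) (B : 'M[D]_n).

Definition mx_nabla (x : 'cV[D]_n) : 'cV[D]_n := map_mx (@der D) x + B *m x.

Lemma mx_nablaD : {morph mx_nabla : x y / x + y}.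
Proof.
move=> x y; rewrite /mx_nabla mulmxDr addrACA; congr (_ + _).
by apply/matrixP => i j; rewrite !mxE derD.
Qed.

Lemma mx_nablaZ (a : D) x : mx_nabla (a *: x) = der a *: x + a *: mx_nabla x.
Proof.
rewrite /mx_nabla scalerDr addrA -scalemxAr; congr (_ + _).
by apply/matrixP => i j; rewrite !mxE derM.
Qed.

Definition dmod_of_mx : dmod D := Dmod mx_nablaD mx_nablaZ.

Lemma coords_dmod_of_mx :
  @coords D dmod_of_mx 'I_n (fun j => delta_mx j 0) (fun i x => x i 0).
Proof.
split=> [i x y|i a x|i j|x]; rewrite ?mxE// ?eqxx ?andbT//.
apply/colP => i; rewrite summxE (bigD1 i)//= big1 ?addr0 => [|j /negbTE ji].
  by rewrite !mxE !eqxx mulr1.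
by rewrite !mxE eq_sym ji mulr0.
Qed.

Lemma dmod_of_mxE i j :
  (@nabla D dmod_of_mx (delta_mx j 0) : 'cV[D]_n) i 0 = B i j.
Proof.
rewrite !mxE (bigD1 j)//= big1 => [|l /negbTE lj]; last first.
  by rewrite mxE lj mulr0.
rewrite mxE !eqxx mulr1 addr0 andbT; case: eqP => _; rewrite ?der1 ?add0r//.
by rewrite (additive0 (@derD D)) add0r.
Qed.

End MatrixDmod.

(** * Exponents as eigenvalues of residue matrices *)

(** Bridges two conventions: [eigenvalue] concerns row vectors, while connection matrices act on
    columns. *)
Lemma char_poly_tr (R : comNzRingType) n (A : 'M[R]_n) :
  char_poly A^T = char_poly A.
Proof.
rewrite /char_poly -[RHS]det_tr; congr (\det _).
by apply/matrixP => i j; rewrite !mxE eq_sym.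
Qed.

(* Since X A = (B + lambda) X, the annihilating polynomial prod (x - beta) of *)
(* B satisfies X prod (A - lambda - beta) = 0, so some factor is singular.    *)
Lemma sylvester_eigenvalue (F : closedFieldType) m n (A : 'M[F]_n)
    (B : 'M[F]_m) (X : 'M[F]_(m, n)) lambda :
  X != 0 -> X *m A - B *m X = lambda *: X ->
  exists alpha beta, [/\ root (char_poly A) alpha, root (char_poly B) beta &
    lambda = alpha - beta].
Proof.
case: m B X => [|m] B X; first by rewrite flatmx0 eqxx.
have [s Bs] := closed_field_poly_normal (char_poly B).
rewrite (monicP (char_poly_monic B)) scale1r in Bs.
have : (\prod_(b <- s) (B - b%:M)) *m X = 0.
  have := Cayley_Hamilton B; rewrite Bs rmorph_prod /=.
  under eq_bigr do rewrite rmorphB /= horner_mx_X horner_mx_C.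
  by rewrite -mulmxE => ->; rewrite mul0mx.
have sB b : b \in s -> root (char_poly B) b by rewrite Bs root_prod_XsubC.
elim/last_ind: s X sB {Bs} => [|s b IH] X sB.
  by rewrite big_nil mul1mx => ->; rewrite eqxx.
rewrite big_rcons /= -mulmxE -mulmxA => sX X0 XE.
(* If [B X = b X], then [X A = (lambda + b) X] and a nonzero row of [X] is an eigenvector of [A].
   Otherwise [(B - b) X] is a nonzero solution of the same equation, with one factor fewer to kill
   it. *)
have [Y0|Y0] := eqVneq ((B - b%:M) *m X) 0.
  exists (lambda + b), b; split; last by rewrite addrK.
    rewrite -eigenvalue_root_char.
    have [i Xi] : exists i, row i X != 0.
      apply: contra_notP (elimN eqP X0) => h'; apply/row_matrixP => i.
      by rewrite row0; apply/eqP; apply: contra_notT h' => ?; exists i.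
    apply/eigenvalueP; exists (row i X) => //.
    rewrite -row_mul; move: XE Y0; rewrite mulmxBl mul_scalar_mx.
    move=> /eqP; rewrite subr_eq => /eqP-> /eqP; rewrite subr_eq0 => /eqP->.
    by rewrite -scalerDl linearZ.
  by apply: sB; rewrite mem_rcons inE eqxx.
apply: (IH ((B - b%:M) *m X)) => //.
  by move=> c cs; apply: sB; rewrite mem_rcons inE cs orbT.
rewrite -mulmxA scalemxAr -XE mulmxBr; congr (_ - _).
by rewrite !mulmxA mulmxBl mulmxBr scalar_mxC.
Qed.

Section Eval.
Variables (E : fieldType) (Z : zRing E).

(** Evaluation at [z = 0], axiomatised so that both rings of power series share the computation of
    the fibre. *)
Definition is_eval (ev : {rmorphism Z -> E}) : Prop :=
  [/\ cancel (zr_const Z) ev, ev (zr_z Z) = 0 &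
      forall a, ev a = 0 -> exists b, a = zr_z Z * b].

Variables (ev : {rmorphism Z -> E}) (evP : is_eval ev).

Lemma eval_repr_fib (M : dmod Z) (I : finType) (e : I -> M) k i x :
  coords e k -> ev (k i (repr (fib x))) = ev (k i x).
Proof.
move=> [kD kZ _ _]; have [t xt] := fib_repr x.
rewrite -[repr (fib x)](subrK x) xt kD kZ rmorphD rmorphM.
by case: evP => _ -> _; rewrite mul0r add0r.
Qed.

Lemma coords_fibre (M : dmod Z) (I : finType) (e : I -> M) k :
  coords e k ->
  coords (fun i => fib (e i)) (fun i x => ev (k i (repr x))).
Proof.
move=> ck; case: (ck) => kD kZ ke kE; case: (evP) => evc evz evI.
split=> [i x y|i c x|i j|x].
- elim/fib_ind: x => x; elim/fib_ind: y => y.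
  by rewrite -fibD !(eval_repr_fib _ _ ck) kD rmorphD.
- elim/fib_ind: x => x; rewrite [_ *: _]fib_scaleE !(eval_repr_fib _ _ ck).
  by rewrite kZ rmorphM evc.
- by rewrite (eval_repr_fib _ _ ck) ke rmorph_nat.
- elim/fib_ind: x => x.
  under eq_bigr do rewrite (eval_repr_fib _ _ ck) [_ *: _]fib_scaleE.
  rewrite -(big_morph _ (@fibD E Z M) (additive0 (@fibD E Z M))).
  apply/eqP/fibP; rewrite {1}[x]kE -sumrB.
  have h i : exists b, k i x - zr_const Z (ev (k i x)) = zr_z Z * b.
    by apply: evI; rewrite rmorphB evc subrr.
  have [b hb] := choice h.
  exists (\sum_i b i *: e i); rewrite scaler_sumr; apply: eq_bigr => i _.
  by rewrite -scalerBl hb scalerA.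
Qed.

Variables (F : fieldType) (iota : {rmorphism E -> F}).

(** The classes [fib (e i)] form a basis of [M / zM], and base change along [iota] only maps the
    entries of the matrix; [c] is a column eigenvector. *)
Lemma exponentP (M : dmod Z) (I : finType) (e : I -> M) k lambda :
  coords e k -> exponent iota M lambda <->
  exists c : I -> F, (exists i, c i != 0) /\
    forall i, \sum_j iota (ev (k i (nabla (e j)))) * c j = lambda * c i.
Proof.
move=> ck; have cf := coords_fibre ck.
pose e' i := bpure iota 1 (fib (e i)).
pose k' := @bc_coord _ _ iota _ _ (fun i (x : fibre M) => ev (k i (repr x))).
pose W := dbc (const_morph iota) (fibre_endo M).
have cW : @coords (const_ring F) W I e' k' := coords_bc iota cf.
have mxW i j : k' i (@nabla _ W (e' j)) = iota (ev (k i (nabla (e j)))).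
  have -> : @nabla _ W (e' j) = bpure iota 1 (fib (nabla (e j))).
    by rewrite /= bc_nabla_pure bpure0l add0r /= fib_nablaE.
  by rewrite /k' (bc_coordE _ cf) mul1r (eval_repr_fib _ _ ck).
split=> [[x [x0 xl]]|[c [[i ci] cl]]].
  exists (k'^~ x); split.
    apply: contra_notP x0 => h; apply: (coords_inj cW) => i.
    case: (cW) => kD _ _ _; rewrite [RHS](additive0 (kD i)).
    by apply/eqP; apply: contra_notT h => ?; exists i.
  move=> i; have := nabla_coords cW x i; rewrite add0r.
  under eq_bigr do rewrite mxW.
  by move=> <-; rewrite xl; case: cW => _ kZ _ _; rewrite kZ.
pose x : W := \sum_i c i *: e' i.
exists x; split.
  move=> x0; move/eqP: ci; apply; rewrite -[LHS](coords_sum cW) -/x x0.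
  by case: cW => kD _ _ _; rewrite (additive0 (kD i)).
apply: (coords_inj cW) => l; rewrite (nabla_coords cW) add0r.
have [_ kZ _ _] := cW; rewrite kZ (coords_sum cW) -cl.
by apply: eq_bigr => j _; rewrite mxW (coords_sum cW).
Qed.

Definition residue (M : dmod Z) n (e : 'I_n -> M) (k : 'I_n -> M -> Z) :
    'M[E]_n := \matrix_(i, j) ev (k i (nabla (e j))).

Lemma exponent_root (M : dmod Z) n (e : 'I_n -> M) k lambda :
  coords e k -> exponent iota M lambda <->
  root (char_poly (map_mx iota (residue e k))) lambda.
Proof.
move=> ck; rewrite -char_poly_tr -eigenvalue_root_char.
apply: (iff_trans (exponentP lambda ck)); split.
  move=> [c [[i ci] cl]]; apply/eigenvalueP; exists (\row_j c j).
    apply/rowP => j; rewrite !mxE -cl; apply: eq_bigr => l _.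
    by rewrite !mxE mulrC.
  by apply/eqP => /rowP/(_ i); rewrite !mxE => /eqP; rewrite (negbTE ci).
move=> /eigenvalueP[u ul /rV0Pn[i ui]]; exists (u 0); split; first by exists i.
move=> j; have /rowP/(_ j) := ul; rewrite !mxE => <-.
by apply: eq_bigr => l _; rewrite !mxE mulrC.
Qed.

End Eval.

Lemma exponents_tensor_stable (E : fieldType) (Z : zRing E)
    (ev : {rmorphism Z -> E}) (F : closedFieldType) (iota : {rmorphism E -> F})
    (S : set F) :
  is_eval ev -> S 0 -> (forall x y, S x -> S y -> S (x - y)) ->
  tensor_stable (exponents_in iota (Z := Z) S).
Proof.
move=> evP S0 SB; split.
  move=> lambda /=.
  have ck : @coords Z (dunit Z) unit (fun=> 1) (fun _ x => x).
    split=> // x; rewrite (big_pred1 tt) => [|[]//].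
    by rewrite /GRing.scale/= mulr1.
  move=> /(exponentP evP iota lambda ck) [c [[[] c0]]] /(_ tt).
  rewrite big1 => [|[] _]; last by rewrite /= der1 !rmorph0 mul0r.
  move=> /esym/eqP; rewrite mulf_eq0 (negbTE c0) orbF => /eqP->.
  exact: S0.
move=> [M fM] [N fN] SM SN lambda /=.
have [m [e [k ck]]] := finite_free_ord fM.
have [n [f [l cl]]] := finite_free_ord fN.
move=> /(exponentP evP iota (M := dtens M N) lambda (coords_tensor ck cl)).
move=> [c [[[i0 j0] c0] cE]].
pose X := \matrix_(i, j) c (i, j).
pose A := map_mx iota (residue ev e k); pose B := map_mx iota (residue ev f l).
(* An eigenvector of [A (x) 1 + 1 (x) B], written as a matrix [X], satisfies
   [A X + X B^T = lambda X]. The sign of [A] puts this in the form of [sylvester_eigenvalue]. *)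
have XE : X *m B^T - (- A) *m X = lambda *: X.
  apply/matrixP => i j; rewrite mulNmx opprK !mxE -(cE (i, j)).
  have [_ _ ke _] := ck; have [_ _ lf _] := cl.
  have bal := balanced_coords i j ck cl.
  pose G a b := iota (ev (tlift (fun m n => k i m * l j n)
    (@nabla _ (dtens M N) (e a %(x) f b)))) * c (a, b).
  rewrite [RHS](eq_bigr (fun p => G p.1 p.2)); last by case.
  rewrite -(pair_bigA _ G) /G /=.
  under [RHS]eq_bigr => a _.
    under eq_bigr => b _.
      rewrite tnabla_pure tliftD// !tlift_pure// ke lf !rmorphD !rmorphM /=.
      rewrite !rmorph_nat mulrDl.
      over.
    rewrite big_split /= (bigD1 j)//= eqxx mulr1 [X in _ + X + _]big1; last first.
      by move=> b; rewrite eq_sym => /negbTE->; rewrite mulr0 mul0r.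
    rewrite addr0; over.
  rewrite big_split /= addrC; congr (_ + _).
    by apply: eq_bigr => a _; rewrite !mxE.
  rewrite [RHS](bigD1 i)//= [X in _ = _ + X]big1 ?addr0.
    by apply: eq_bigr => b _; rewrite !mxE eqxx mul1r mulrC.
  move=> a; rewrite eq_sym => /negbTE ia; apply: big1 => b _.
  by rewrite ia !mul0r.
have X0 : X != 0.
  by apply/eqP => /matrixP/(_ i0 j0); rewrite !mxE => /eqP; rewrite (negbTE c0).
have [a [b [Ba Ab ->]]] := sylvester_eigenvalue X0 XE.
have Sa : S a.
  by apply: SN; apply/(exponent_root evP iota a cl); rewrite char_poly_tr in Ba.
have Sb : S (- b).
  apply: SM; apply/(exponent_root evP iota (- b) ck).
  rewrite -eigenvalue_root_char; apply/eigenvalueP.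
  move: Ab; rewrite -eigenvalue_root_char => /eigenvalueP[u uE u0].
  by exists u => //; rewrite scaleNr -uE mulmxN opprK.
have : S (a - (0 - - b)) by apply/SB/SB.
by rewrite sub0r opprK.
Qed.

(** * Factorials and small divisors *)

Lemma logn_fact_le p n : prime p -> (logn p n`! <= n)%N.
Proof.
(* After Legendre's formula, the extra term [n %/ p ^ K] carries the induction on [K]: as [p >= 2],
   twice the next term is at most this one. *)
move=> p_pr; rewrite logn_fact// big_add1 /=.
suff h K : (\sum_(0 <= k < K) n %/ p ^ k.+1 + n %/ p ^ K <= n)%N.
  exact: leq_trans (leq_addr _ _) (h n).
elim: K => [|K IH]; first by rewrite big_geq// divn1.
rewrite big_nat_recr//=; apply: leq_trans IH; rewrite -addnA leq_add2l.
rewrite expnSr divnMA addnn -mul2n.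
apply: leq_trans (leq_trunc_div (n %/ p ^ K) p).
by rewrite mulnC leq_mul2l prime_gt1 ?orbT.
Qed.

Section SmallDivisors.
Variables (R : realType) (F : fieldType) (w : absval R F) (p : nat).
Hypotheses (p_pr : prime p) (wp : w p%:R = p%:R^-1).

Let p_gt0 : 0 < p%:R :> R. Proof. by rewrite ltr0n prime_gt0. Qed.

Lemma avX x n : w (x ^+ n) = w x ^+ n.
Proof. by elim: n => [|n IH]; rewrite ?expr0 ?av1// !exprS avM IH. Qed.

(** If [k] had absolute value below 1, a Bezout relation would write 1 as a difference of two
    elements of absolute value below 1. *)
Lemma av_coprime k : coprime p k -> w k%:R = 1.
Proof.
move=> pk; apply/eqP; rewrite eq_le av_nat /= leNgt; apply/negP => k1.
have p1 : w p%:R < 1 by rewrite wp invf_lt1// ltr1n prime_gt1.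
have k0 : (0 < k)%N.
  case: k pk k1 => [|//]; rewrite /coprime gcdn0 => /eqP p1'.
  by move: p_pr; rewrite p1'.
have [a b ab _] := egcdnP p k0.
have : w (a%:R * k%:R - b%:R * p%:R) = 1.
  by rewrite -!natrM ab gcdnC (eqP pk) natrD addrAC subrr add0r av1.
have := av_ultra w (a%:R * k%:R) (- (b%:R * p%:R)).
rewrite avN !avM => + h; rewrite h le_max => /orP[]; apply/negP; rewrite -ltNge.
  by rewrite (le_lt_trans _ k1)// ler_piMl ?av_ge0// av_nat.
by rewrite (le_lt_trans _ p1)// ler_piMl ?av_ge0// av_nat.
Qed.

Lemma av_fact_ge n : p%:R^-1 ^+ n <= w n`!%:R.
Proof.
have [u pu ->] := pfactor_coprime p_pr (fact_gt0 n).
rewrite natrM natrX avM av_coprime// mul1r avX wp.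
apply: ler_wiXn2l; first by rewrite invr_ge0 ltW.
  by rewrite invf_le1// ler1n prime_gt0.
exact: logn_fact_le.
Qed.

Lemma prod_av_sub n : \prod_(m < n) w (n - m)%:R = w n`!%:R.
Proof.
elim: n => [|n IH]; first by rewrite big_ord0 av1.
by rewrite big_ord_recl factS natrM avM subn0 -IH.
Qed.

Lemma prod_av_succ n : \prod_(m < n) w m.+1%:R = w n`!%:R.
Proof.
elim: n => [|n IH]; first by rewrite big_ord0 av1.
by rewrite big_ord_recr /= IH factS natrM avM mulrC.
Qed.

Lemma av_dist m n : w (m - n + (n - m))%:R = w (m%:R - n%:R).
Proof.
have [mn|nm] := leqP m n.
  by rewrite (eqP mn) add0n natrB// -avN opprB.
by rewrite (eqP (ltnW nm)) addn0 natrB// ltnW.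
Qed.

(** With truncated subtraction [m - m0 + (m0 - m)] is a distance; these run through [1, ..., m0]
    below [m0] and [1, ..., n - m0] above it. *)
Lemma prod_av_dist n m0 : (m0 <= n)%N ->
  \prod_(0 <= m < n.+1 | m != m0) w (m - m0 + (m0 - m))%:R =
  w m0`!%:R * w (n - m0)`!%:R.
Proof.
move=> m0n; rewrite (@big_cat_nat _ _ _ m0)//=; last exact: leqW.
congr (_ * _).
  rewrite -prod_av_sub -(big_mkord xpredT (fun m => w (m0 - m)%:R)).
  rewrite big_nat_cond [RHS]big_nat_cond; apply: eq_big => m.
    by case: ltngtP.
  by move=> /andP[/andP[_ /ltnW/eqP->]]; rewrite add0n.
rewrite big_ltn_cond//= eqxx/= -prod_av_succ -{1}[m0.+1]add0n big_addn subSS.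
rewrite big_mkord; apply: eq_big => m.
  by rewrite addnS gtn_eqF// ltnS leq_addl.
by move=> _; rewrite addnS -addSn addnK (eqP (leq_addl _ _)) addn0.
Qed.

(** The value 1 at [m = lambda] mirrors the term omitted from [type_coef] and keeps every factor
    positive. *)
Definition divisor (lambda : F) (m : nat) : R :=
  if lambda == m%:R then 1 else w (lambda - m%:R).

Lemma divisor_gt0 lambda m : 0 < divisor lambda m.
Proof.
rewrite /divisor; case: eqVneq => // lm.
by rewrite lt_neqAle av_ge0 eq_sym av_eq0 subr_eq0 lm.
Qed.

(* At most one factor is small: if lambda - m0 is the smallest one, then      *)
(* |lambda - m| >= |m - m0| for the others, whose product is bounded below by *)
(* the absolute value of a factorial.                                         *)
Lemma prod_divisor_ge lambda : (0 < ptype w lambda)%E ->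
  exists c rho : R, [/\ 0 < c, 0 < rho &
    forall n, c * rho ^+ n <= \prod_(m < n) divisor lambda m].
Proof.
move=> /radius_gt0P[r0 [C0 [r0_gt0 hC0]]].
(* This makes [C^-1 * r ^+ m] at most 1, which covers the default value of [divisor]. *)
pose C := Num.max 1 C0; pose r := Num.min 1 r0.
have C1 : 1 <= C by rewrite le_max lexx.
have C_gt0 : 0 < C := lt_le_trans ltr01 C1.
have r_gt0 : 0 < r by rewrite lt_min ltr01.
have r_le1 : r <= 1 by rewrite ge_min lexx.
have hdiv m : C^-1 * r ^+ m <= divisor lambda m.
  rewrite /divisor; case: eqVneq => lm.
    apply: mulr_ile1; first by rewrite invr_ge0 ltW.
    - by rewrite exprn_ge0// ltW.
    - by rewrite invf_le1.
    - by rewrite exprn_ile1// ltW.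
  have wm : 0 < w (lambda - m%:R).
    by rewrite lt_neqAle av_ge0 eq_sym av_eq0 subr_eq0 lm.
  have := hC0 m; rewrite /type_coef (negbTE lm) => h.
  rewrite mulrC ler_pdivrMr// -ler_pdivrMl//.
  have -> : (w (lambda - m%:R))^-1 = w (lambda - m%:R)^-1.
    apply: (mulIf (lt0r_neq0 wm)); rewrite mulVf ?lt0r_neq0// -avM mulVf ?av1//.
    by rewrite subr_eq0.
  apply: (@le_trans _ _ C0); last by rewrite le_max lexx orbT.
  apply: le_trans h; rewrite ler_wpM2l ?av_ge0// lerXn2r ?nnegrE//.
  - exact: ltW.
  - exact: ltW.
  - by rewrite ge_min lexx orbT.
(* [C^-1] and the powers of [r] pay for the smallest factor, the powers of [p^-1] for the factorials
   bounding all the others. *)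
exists C^-1, (r * p%:R^-1); split; first by rewrite invr_gt0.
  by rewrite mulr_gt0// invr_gt0.
case=> [|n]; first by rewrite big_ord0 expr0 mulr1 invf_le1.
have [m0 _ hm0] := @arg_minP _ _ 'I_n.+1 ord0 xpredT
  (fun m => w (lambda - m%:R)) isT.
have hm (m : 'I_n.+1) : m != m0 ->
    w (m - m0 + (m0 - m))%:R <= divisor lambda m.
  move=> mm0; rewrite /divisor; case: eqVneq => [_|lm]; first exact: av_nat.
  rewrite av_dist.
  have -> : m%:R - m0%:R = (lambda - m0%:R) - (lambda - m%:R).
    by rewrite opprB [RHS]addrC addrA subrK.
  apply: le_trans (av_ultra _ _ _) _.
  by rewrite avN ge_max lexx andbT; exact: hm0.
have Ci_ge0 : 0 <= C^-1 by rewrite invr_ge0 ltW.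
have pi_ge0 : 0 <= p%:R^-1 :> R by rewrite invr_ge0 ltW.
rewrite (bigD1 m0)//= exprMn mulrA; apply: ler_pM.
- by rewrite mulr_ge0// exprn_ge0// ltW.
- exact: exprn_ge0.
- apply: le_trans (hdiv m0); apply: ler_wpM2l => //.
  by apply: ler_wiXn2l => //; [exact: ltW | exact: ltnW].
apply: (@le_trans _ _ (\prod_(m < n.+1 | m != m0) w (m - m0 + (m0 - m))%:R)).
  have m0n : (m0 <= n)%N by rewrite -ltnS.
  rewrite -(big_mkord (fun m => m != m0 :> nat)
    (fun m => w (m - m0 + (m0 - m))%:R)) prod_av_dist//.
  apply: (@le_trans _ _ (p%:R^-1 ^+ n)).
    by apply: ler_wiXn2l => //; rewrite invf_le1// ler1n prime_gt0.
  rewrite -{1}(subnKC m0n) exprD.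
  by apply: ler_pM; rewrite ?exprn_ge0 ?av_fact_ge.
by apply: ler_prod => m mm0; rewrite av_ge0 hm.
Qed.

End SmallDivisors.

(** * Ultrametric bounds for determinants and products of divisors *)

Lemma horner_char_poly (R : comNzRingType) n (A : 'M[R]_n) a :
  (char_poly A).[a] = \det (a%:M - A).
Proof.
rewrite -[LHS]/(horner_eval a _) /char_poly -det_map_mx; congr (\det _).
by apply/matrixP => i j; rewrite !mxE /= /horner_eval hornerD hornerN
  hornerMn hornerX hornerC.
Qed.

Lemma nat_notin_large (F : fieldType) (s : seq F) : [pchar F] =i pred0 ->
  exists N, forall m, (N <= m)%N -> m%:R \notin s.
Proof.
move=> /pcharf0P F0; elim: s => [|x s [N hN]]; first by exists 0%N.
have [[k kx]|nx] := pselect (exists k : nat, k%:R = x); last first.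
  exists N => m /hN ms; rewrite inE negb_or ms andbT.
  by apply: contra_notN nx => /eqP; exists m.
exists (maxn N k.+1) => m; rewrite geq_max => /andP[/hN ms km].
rewrite inE negb_or ms andbT -kx -subr_eq0 -natrB 1?ltnW// F0.
by rewrite subn_eq0 -ltnNge.
Qed.

Section Bounds.
Variables (R : realType) (F : fieldType) (w : absval R F).

Lemma av_big_le (I : Type) (r : seq I) (P : pred I) (f : I -> F) C : 0 <= C ->
  (forall i, P i -> w (f i) <= C) -> w (\sum_(i <- r | P i) f i) <= C.
Proof.
move=> C0 fC; apply: (big_ind (fun x => w x <= C)) => //.
  by rewrite av0.
by move=> x y xC yC; rewrite (le_trans (av_ultra _ _ _))// ge_max xC.
Qed.

Lemma av_prod (I : Type) (r : seq I) (P : pred I) (f : I -> F) :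
  w (\prod_(i <- r | P i) f i) = \prod_(i <- r | P i) w (f i).
Proof. exact: (big_morph w (avM w) (av1 w)). Qed.

Lemma av_det_le n (M : 'M[F]_n) C :
  (forall i j, w (M i j) <= C) -> w (\det M) <= C ^+ n.
Proof.
case: n M => [|n] M MC; first by rewrite det_mx00 av1.
have C0 : 0 <= C := le_trans (av_ge0 _ _) (MC ord0 ord0).
apply: av_big_le => [|s _]; first exact: exprn_ge0.
rewrite avM avX avN av1 expr1n mul1r av_prod.
rewrite -[X in _ <= _ ^+ X]card_ord -prodr_const.
by apply: ler_prod => i _; rewrite av_ge0 MC.
Qed.

Lemma av_adj_le n (M : 'M[F]_n) C : 1 <= C ->
  (forall i j, w (M i j) <= C) -> forall i j, w (\adj M i j) <= C ^+ n.
Proof.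
move=> C1 MC i j; rewrite mxE avM avX avN av1 expr1n mul1r.
apply: (@le_trans _ _ (C ^+ n.-1)); last by rewrite ler_weXn2l// leq_pred.
by apply: av_det_le => a b; rewrite !mxE.
Qed.

Lemma divisor_le (lambda : F) m : divisor w lambda m <= Num.max 1 (w lambda).
Proof.
rewrite /divisor; case: ifP => _; first by rewrite le_max lexx.
rewrite (le_trans (av_ultra _ _ _))// ge_max le_max lexx orbT/= avN.
by rewrite le_max av_nat.
Qed.

Lemma prod_divisors_ge p (s : seq F) : prime p -> w p%:R = p%:R^-1 ->
  (forall lambda, lambda \in s -> (0 < ptype w lambda)%E) ->
  exists c rho : R, [/\ 0 < c, 0 < rho & forall n,
    c * rho ^+ n <= \prod_(m < n) \prod_(lambda <- s) divisor w lambda m].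
Proof.
move=> p_pr wp; elim: s => [|x s IH] sP.
  by exists 1, 1; split=> // n; rewrite expr1n mul1r big1// => m _; rewrite big_nil.
have [l ls|c [rho [c0 rho0 hc]]] := IH; first by apply: sP; rewrite inE ls orbT.
have [|c' [rho' [c'0 rho'0 hc']]] := @prod_divisor_ge _ _ w _ p_pr wp x.
  by apply: sP; rewrite inE eqxx.
exists (c' * c), (rho' * rho); split=> [||n]; rewrite ?mulr_gt0//.
under eq_bigr do rewrite big_cons.
rewrite big_split exprMn mulrACA.
by apply: ler_pM; rewrite // mulr_ge0 ?exprn_ge0 ?ltW.
Qed.

End Bounds.

(** * Growth of solutions of the recursion *)

Section Recursion.
Variables (R : realType) (p : nat) (E : fieldType) (F : closedFieldType).
Variables (iota : {rmorphism E -> F}) (v : absval R E) (w : absval R F).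
Hypotheses (p_pr : prime p) (F0 : [pchar F] =i pred0).
Hypotheses (vp : v p%:R = p%:R^-1) (wv : forall x, w (iota x) = v x).

Section System.
Variables (d : nat) (T : nat -> 'M[E]_d) (x : nat -> 'rV[E]_d).
Hypothesis xE : forall n,
  n%:R *: x n = \sum_(i < n.+1) x (n - i)%N *m T i.

Lemma recursion_adj n : \det (n%:R%:M - T 0%N) *: x n =
  \sum_(i < n) x (n - i.+1)%N *m T i.+1 *m \adj (n%:R%:M - T 0%N).
Proof.
rewrite -mul_mx_scalar -mul_mx_adj mulmxA mulmxBr mul_mx_scalar xE.
by rewrite big_ord_recl subn0 addrAC subrr add0r mulmx_suml.
Qed.

(** Let [a_n] be the largest entry of [x n] times [r ^ n]. By [recursion_adj], [|det (n - T_0)| a_n]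
    is at most [K ^ (d + 1)] times the largest earlier [a_m], and the determinant is the product of
    the [|n - l|] over the eigenvalues [l] of [T_0]. Iteration bounds [a_n] by a geometric factor
    over a product of divisors, which [prod_divisors_ge] bounds below. *)
Lemma recursion_bound (r K : R) : 0 < r ->
  (forall n i j, v (T n i j) * r ^+ n <= K) ->
  (forall l, root (char_poly (map_mx iota (T 0%N))) l -> (0 < ptype w l)%E) ->
  exists r' C : R, 0 < r' /\ forall n j, v (x n 0 j) * r' ^+ n <= C.
Proof.
move=> r0; wlog K1 : K / 1 <= K => [hw TK|TK sP].
  apply: (hw (Num.max 1 K)); first by rewrite le_max lexx.
  by move=> n i j; rewrite le_max TK orbT.
have K0 : 0 < K := lt_le_trans ltr01 K1.
have [s sE] := closed_field_poly_normal (char_poly (map_mx iota (T 0%N))).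
rewrite (monicP (char_poly_monic _)) scale1r in sE.
have detE m : v (\det (m%:R%:M - T 0%N)) = \prod_(l <- s) w (m%:R - l).
  rewrite -wv -det_map_mx map_mxB map_scalar_mx rmorph_nat -horner_char_poly sE.
  by rewrite horner_prod av_prod; under eq_bigr do rewrite hornerXsubC.
have [||c [rho [c0 rho0 hc]]] := @prod_divisors_ge _ _ w p s p_pr.
- by rewrite -(rmorph_nat iota) wv.
- by move=> l ls; apply: sP; rewrite sE root_prod_XsubC.
have [N hN] := nat_notin_large s F0.
pose Lam := \prod_(l <- s) Num.max 1 (w l).
have Lam1 : 1 <= Lam.
  apply: (big_ind (fun x : R => 1 <= x)) => // [a b a1 b1|l _].
    by rewrite mulr_ege1.
  by rewrite le_max lexx.
(* [L] absorbs the constant of Cramer's rule and, through [Lam], forces [e m <= 1]; then [P]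
   decreases and the bound [C / P n] only weakens with [n]. *)
pose L := K ^+ d.+1 * Lam.
have Kd1 : 1 <= K ^+ d.+1 by rewrite exprn_ege1.
have L0 : 0 < L by rewrite mulr_gt0// (lt_le_trans ltr01).
pose e m := L^-1 * \prod_(l <- s) divisor w l m.
have e_gt0 m : 0 < e m.
  by rewrite mulr_gt0 ?invr_gt0// prodr_gt0// => l _; exact: divisor_gt0.
have e_le1 m : e m <= 1.
  rewrite ler_pdivrMl// mulr1; apply: (@le_trans _ _ Lam).
    by apply: ler_prod => l _; rewrite ltW ?divisor_gt0// divisor_le.
  by rewrite ler_peMl// (le_trans ler01).
pose P n := \prod_(m < n) e m.
have P_gt0 n : 0 < P n by apply: prodr_gt0.
have PS n : P n.+1 = P n * e n by rewrite /P big_ord_recr.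
have P_le1 n : P n <= 1.
  by apply: prodr_ile1 => m _; rewrite e_le1 ltW.
(* Covers the indices below [N], where [n - T_0] may be singular. *)
pose C := \sum_(n < N) \sum_j v (x n 0 j) * r ^+ n.
have term_ge0 n j : 0 <= v (x n 0 j) * r ^+ n.
  by rewrite mulr_ge0 ?av_ge0 ?exprn_ge0 ?ltW.
have C0 : 0 <= C by apply: sumr_ge0 => n _; apply: sumr_ge0 => j _.
have main n : forall m j, (m < n)%N -> v (x m 0 j) * r ^+ m <= C / P n.
  elim: n => [//|n IH] m j; rewrite ltnS leq_eqVlt => /orP[/eqP->{m}|mn]; last first.
    apply: le_trans (IH _ _ mn) _; rewrite ler_wpM2l// lef_pV2 ?posrE//.
    by rewrite PS ler_piMr// ltW.
  have [nN|Nn] := ltnP n N.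
    apply: (@le_trans _ _ C); last by rewrite ler_peMr// invf_ge1.
    rewrite /C (bigD1 (Ordinal nN))//= (bigD1 j)//= -addrA lerDl addr_ge0//.
      by apply: sumr_ge0.
    by apply: sumr_ge0 => i _; apply: sumr_ge0.
  have De : v (\det (n%:R%:M - T 0%N)) = L * e n.
    rewrite detE /e mulVKf ?lt0r_neq0// !big_seq; apply: eq_bigr => l ls.
    rewrite /divisor ifF; first by rewrite -avN opprB.
    by apply: contraNF (hN _ Nn) => /eqP<-.
  have B0 : 0 <= C / P n by rewrite divr_ge0// ltW.
  have TE (i j' : 'I_d) : v ((n%:R%:M - T 0%N) i j') <= K.
    rewrite !mxE; apply: le_trans (av_ultra _ _ _) _; rewrite avN ge_max.
    have := TK 0%N i j'; rewrite expr0 mulr1 => ->; rewrite andbT.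
    by case: eqP => _; rewrite ?mulr1n ?mulr0n ?av0 ?(ltW K0)//
      (le_trans _ K1)// av_nat.
  have rn : 0 < r ^+ n by rewrite exprn_gt0.
  suff : L * e n * v (x n 0 j) * r ^+ n <= K ^+ d.+1 * (C / P n).
    have Kd0 : 0 < K ^+ d.+1 := lt_le_trans ltr01 Kd1.
    move=> h; rewrite PS invfM mulrA ler_pdivlMr// -(ler_pM2l Kd0).
    apply: le_trans h; rewrite /L.
    have -> : K ^+ d.+1 * Lam * e n * v (x n 0 j) * r ^+ n =
        Lam * (K ^+ d.+1 * (v (x n 0 j) * r ^+ n * e n)) by ring.
    apply: ler_peMl => //; apply: mulr_ge0; first exact: ltW.
    by apply: mulr_ge0; [exact: term_ge0 | exact: ltW].
  have Q0 : 0 <= K ^+ d.+1 * (C / P n) / r ^+ n.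
    exact: divr_ge0 (mulr_ge0 (exprn_ge0 _ (ltW K0)) B0) (ltW rn).
  rewrite -De -avM -ler_pdivlMr//.
  have -> : \det (n%:R%:M - T 0%N) * x n 0 j = (\det (n%:R%:M - T 0%N) *: x n) 0 j.
    by rewrite mxE.
  rewrite recursion_adj summxE; apply: av_big_le => // i _.
  rewrite mxE; apply: av_big_le => // l _.
  rewrite mxE mulr_suml; apply: av_big_le => // m _.
  rewrite ler_pdivlMr// !avM -[in r ^+ n](@subnK i.+1 n)// exprD.
  have -> (a b c' y z : R) : a * b * c' * (y * z) = c' * (b * z) * (a * y).
    by ring.
  rewrite [K ^+ _]exprSr; apply: ler_pM.
  - by rewrite !mulr_ge0 ?av_ge0 ?exprn_ge0 ?ltW.
  - exact: term_ge0.
  - apply: ler_pM; rewrite ?mulr_ge0 ?av_ge0 ?exprn_ge0 ?(ltW r0)//.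
    exact: av_adj_le.
  - by apply: IH; rewrite ltn_subrL /= (leq_ltn_trans _ (ltn_ord i)).
(* Read off from [C / P n.+1] and the lower bound [c * rho ^+ n.+1 / L ^+ n.+1] of [P n.+1]. *)
exists (r * rho / L), (C * L / (c * rho)); split.
  exact: divr_gt0 (mulr_gt0 r0 rho0) L0.
move=> n j; have := main n.+1 n j (ltnSn n).
have LPn : c * rho ^+ n.+1 / L ^+ n.+1 <= P n.+1.
  rewrite /P big_split /= prodr_const card_ord exprVn mulrC ler_wpM2l//.
  by rewrite invr_ge0 exprn_ge0// ltW.
have cr0 : 0 < c * rho ^+ n.+1 / L ^+ n.+1.
  by apply: divr_gt0; [apply: mulr_gt0 => // |]; apply: exprn_gt0.
move=> h; rewrite -mulrA exprMn mulrA.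
have q0 : 0 < (rho / L) ^+ n by apply: exprn_gt0; exact: divr_gt0.
rewrite -ler_pdivlMr//; apply: le_trans h _.
apply: (@le_trans _ _ (C / (c * rho ^+ n.+1 / L ^+ n.+1))).
  by rewrite ler_wpM2l// lef_pV2 ?posrE.
rewrite expr_div_n !exprS.
have := lt0r_neq0 L0; have := lt0r_neq0 rho0; have := lt0r_neq0 c0.
have : rho ^+ n != 0 by rewrite expf_neq0// lt0r_neq0.
have : L ^+ n != 0 by rewrite expf_neq0// lt0r_neq0.
move: (L ^+ n) (rho ^+ n) => Ln rn Ln0 rn0 cn0 rhon0 Ln0'.
rewrite le_eqVlt; apply/orP; left; apply/eqP; field.
by rewrite Ln0 rn0 cn0 rhon0 Ln0'.
Qed.

End System.

End Recursion.

(** * Existence and uniqueness of formal solutions *)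

Lemma strong_recursion (U : Type) (u0 : U) (f : nat -> (nat -> U) -> U) :
  exists x : nat -> U,
    forall n, x n = f n (fun i => if (i < n)%N then x i else u0).
Proof.
pose fix s n := if n is m.+1 then rcons (s m) (f m (nth u0 (s m))) else [::].
have size_s n : size (s n) = n by elim: n => //= n IH; rewrite size_rcons IH.
have nth_s n i : (i < n)%N -> nth u0 (s n) i = nth u0 (s i.+1) i.
  elim: n => // n IH; rewrite ltnS leq_eqVlt => /orP[/eqP->//|i_n].
  by rewrite -IH//= nth_rcons size_s i_n.
exists (fun n => nth u0 (s n.+1) n) => n.
transitivity (nth u0 (rcons (s n) (f n (nth u0 (s n)))) n) => //.
rewrite nth_rcons size_s ltnn eqxx; congr f; apply/funext => i.
case: ltnP => [i_n|n_i]; first exact: nth_s.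
by rewrite nth_default// size_s.
Qed.

Section FormalRecursion.
Variables (E : fieldType) (d : nat) (T : nat -> 'M[E]_d).

Definition solution (x : nat -> 'rV[E]_d) : Prop :=
  forall n, n%:R *: x n = \sum_(i < n.+1) x (n - i)%N *m T i.

Lemma solution_unique N x : solution x ->
  (forall n, (N <= n)%N -> n%:R%:M - T 0%N \in unitmx) ->
  (forall n, (n < N)%N -> x n = 0) -> forall n, x n = 0.
Proof.
move=> xE TU xN; elim/ltn_ind => n IH; have [/xN//|Nn] := ltnP n N.
apply: (can_inj (mulmxK (TU n Nn))).
rewrite mul0mx mulmxBr mul_mx_scalar xE big_ord_recl subn0 addrAC subrr add0r.
rewrite big1// => i _; rewrite IH ?mul0mx//.
by rewrite ltn_subrL /= (leq_ltn_trans _ (ltn_ord i)).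
Qed.

(** Below [N] the values [u, 0, ..., 0] satisfy the recursion because every [T n] there kills [u];
    from [N] on it can be solved for [x n]. *)
Lemma solution_exists N u : (0 < N)%N ->
  (forall n, (N <= n)%N -> n%:R%:M - T 0%N \in unitmx) ->
  (forall n, (n < N)%N -> u *m T n = 0) ->
  exists x, [/\ solution x, x 0%N = u &
    forall n, (0 < n < N)%N -> x n = 0].
Proof.
move=> N0 TU uT.
have [x xE] := strong_recursion (0 : 'rV[E]_d) (fun n y =>
  if n == 0%N then u else if (n < N)%N then 0 else
  (\sum_(i < n) y (n - i.+1)%N *m T i.+1) *m invmx (n%:R%:M - T 0%N)).
have x0 : x 0%N = u by rewrite xE.
have xN n : (0 < n < N)%N -> x n = 0.
  by case/andP=> n0 nN; rewrite xE eqn0Ngt n0 nN.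
exists x; split=> // n.
have [->|n0] := posnP n; first by rewrite scale0r big_ord1 x0 uT.
have [nN|Nn] := ltnP n N.
  rewrite xN ?n0// scaler0 big_ord_recr /= subnn x0 uT// addr0 big1// => i _.
  rewrite xN ?mul0mx// subn_gt0 ltn_ord (leq_ltn_trans _ nN)//.
  exact: leq_subr.
have := mulmxKV (TU n Nn) (\sum_(i < n) x (n - i.+1)%N *m T i.+1).
have -> : (\sum_(i < n) x (n - i.+1)%N *m T i.+1) *m invmx (n%:R%:M - T 0%N) = x n.
  rewrite [RHS]xE eqn0Ngt n0 ltnNge Nn /=; congr (_ *m _).
  by apply: eq_bigr => i _; rewrite ltn_subrL /= n0.
by rewrite mulmxBr mul_mx_scalar big_ord_recl subn0 => <-; rewrite addrC subrK.
Qed.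

End FormalRecursion.

(** * Horizontal matrices of power series as solutions of a recursion *)

Section CoefficientMatrices.
Variable E : fieldType.

Definition coefmx m n (k : nat) (A : 'M[fps E]_(m, n)) : 'M[E]_(m, n) :=
  map_mx (fun a : fps E => a k) A.

Definition thetamx m n (A : 'M[fps E]_(m, n)) : 'M[fps E]_(m, n) :=
  map_mx (@fps_theta E) A.

Lemma fps_sumE (I : Type) (r : seq I) (P : pred I) (f : I -> fps E) k :
  (\sum_(i <- r | P i) f i) k = \sum_(i <- r | P i) f i k.
Proof. exact: (big_morph (fun a : fps E => a k)). Qed.

Lemma coefmxP m n (A B : 'M[fps E]_(m, n)) :
  (forall k, coefmx k A = coefmx k B) -> A = B.
Proof.
move=> AB; apply/matrixP => i j; apply/funext => k.
by have /matrixP/(_ i j) := AB k; rewrite !mxE.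
Qed.

Lemma coefmxB m n k (A B : 'M[fps E]_(m, n)) :
  coefmx k (A - B) = coefmx k A - coefmx k B.
Proof. by apply/matrixP => i j; rewrite !mxE. Qed.

Lemma coefmx1 n k : coefmx k (1%:M : 'M[fps E]_n) = (k == 0%N)%:R%:M.
Proof.
apply/matrixP => i j; rewrite !mxE.
by case: (i == j); rewrite ?mulr1n ?mulr0n.
Qed.

Lemma coefmxM m n q k (A : 'M[fps E]_(m, n)) (B : 'M[fps E]_(n, q)) :
  coefmx k (A *m B) = \sum_(s < k.+1) coefmx s A *m coefmx (k - s)%N B.
Proof.
apply/matrixP => i j; rewrite !mxE fps_sumE summxE.
under [RHS]eq_bigr do rewrite mxE.
rewrite exchange_big; apply: eq_bigr => l _.
by apply: eq_bigr => s _; rewrite !mxE.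
Qed.

Lemma coefmx_theta m n k (A : 'M[fps E]_(m, n)) :
  coefmx k (thetamx A) = k%:R *: coefmx k A.
Proof. by apply/matrixP => i j; rewrite !mxE. Qed.

Lemma thetamxM m n q (A : 'M[fps E]_(m, n)) (B : 'M[fps E]_(n, q)) :
  thetamx (A *m B) = thetamx A *m B + A *m thetamx B.
Proof.
apply/matrixP => i j; rewrite !mxE.
rewrite (big_morph _ (@fps_thetaD E) (additive0 (@fps_thetaD E))) -big_split.
by apply: eq_bigr => l _; rewrite fps_thetaM !mxE.
Qed.

Definition sylvester m n (A : 'M[E]_n) (B : 'M[E]_m) : 'M[E]_(m * n) :=
  lin_mulmxr A - lin_mulmx B.

Lemma mul_vec_sylvester m n (A : 'M[E]_n) (B : 'M[E]_m) X :
  mxvec X *m sylvester A B = mxvec (X *m A - B *m X).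
Proof. by rewrite mulmxBr !mul_vec_lin linearB. Qed.

Lemma horizontal_solution m n (A : 'M[fps E]_n) (B : 'M[fps E]_m)
    (X : 'M[fps E]_(m, n)) :
  thetamx X = X *m A - B *m X <->
  solution (fun k => sylvester (coefmx k A) (coefmx k B))
    (fun k => mxvec (coefmx k X)).
Proof.
have h k : \sum_(i < k.+1) mxvec (coefmx (k - i)%N X) *m
      sylvester (coefmx i A) (coefmx i B) = mxvec (coefmx k (X *m A - B *m X)).
  (* Reversing the first Cauchy product makes both sums pair [X_(k-i)] with the [i]-th coefficient
     of a connection. *)
  rewrite coefmxB !coefmxM [X in X - _](reindex_inj rev_ord_inj) -sumrB.
  rewrite linear_sum; apply: eq_bigr => i _.
  by rewrite mul_vec_sylvester /= subSS subKn// -ltnS.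
split=> [XE k|xE]; first by rewrite h -XE coefmx_theta linearZ.
apply: coefmxP => k; rewrite coefmx_theta; apply: (can_inj mxvecK).
by rewrite linearZ /= xE h.
Qed.

Lemma vec_sylvester_eigen m n (A : 'M[E]_n) (B : 'M[E]_m) l :
  eigenvalue (sylvester A B) l ->
  exists2 X : 'M[E]_(m, n), X *m A - B *m X = l *: X & X != 0.
Proof.
move=> /eigenvalueP[u ul u0]; exists (vec_mx u); last by rewrite vec_mx_eq0.
apply: (can_inj mxvecK); rewrite -mul_vec_sylvester.
by rewrite vec_mxK ul linearZ /= vec_mxK.
Qed.

End CoefficientMatrices.

Lemma map_sylvester (E F : fieldType) (f : {rmorphism E -> F}) m n
    (A : 'M[E]_n) (B : 'M[E]_m) :
  map_mx f (sylvester A B) = sylvester (map_mx f A) (map_mx f B).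
Proof.
rewrite map_mxB; congr (_ - _); apply: map_lin_mx => X /=; exact: map_mxM.
Qed.

(** * Gauge equivalence with a truncation *)

Section Gauge.
Variables (E : fieldType) (F : closedFieldType) (iota : {rmorphism E -> F}).
Hypothesis F0 : [pchar F] =i pred0.

Lemma nat_sub_unitmx d (T : 'M[E]_d) :
  exists2 N, (0 < N)%N & forall k, (N <= k)%N -> k%:R%:M - T \in unitmx.
Proof.
have [s sE] := closed_field_poly_normal (char_poly (map_mx iota T)).
rewrite (monicP (char_poly_monic _)) scale1r in sE.
have [N hN] := nat_notin_large s F0.
exists N.+1 => // k /ltnW/hN; rewrite unitmxE unitfE -(fmorph_eq0 iota).
rewrite -det_map_mx map_mxB map_scalar_mx rmorph_nat -horner_char_poly.
by rewrite -rootE sE root_prod_XsubC.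
Qed.

(* P and Q are the unique solutions congruent to 1 mod z^N; P Q and Q P solve *)
(* the equations of the identity, so uniqueness makes P and Q inverse.        *)
Lemma gauge_truncation n (A : 'M[fps E]_n) : exists2 N, (0 < N)%N &
  forall B : 'M[fps E]_n, (forall k, (k < N)%N -> coefmx k B = coefmx k A) ->
  exists P Q : 'M[fps E]_n, [/\ P *m Q = 1%:M, Q *m P = 1%:M,
    thetamx P = P *m A - B *m P & thetamx Q = Q *m B - A *m Q].
Proof.
have [N N0 hN] := nat_sub_unitmx (sylvester (coefmx 0 A) (coefmx 0 A)).
exists N => // B AB; have AB0 := AB 0%N N0.
(* Stated for two connections so as to give both [P] and [Q]. The identity is an admissible start
   because [C] and [D] agree modulo [z^N]. *)
have ex (C D : 'M[fps E]_n) :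
    (forall k, (k < N)%N -> coefmx k C = coefmx k A) ->
    (forall k, (k < N)%N -> coefmx k D = coefmx k A) ->
  exists2 P, thetamx P = P *m C - D *m P &
    forall k, (k < N)%N -> coefmx k P = coefmx k 1%:M.
  move=> CA DA.
  have [||x [xE x0 xN]] := @solution_exists E (n * n)
    (fun k => sylvester (coefmx k C) (coefmx k D)) N (mxvec 1%:M) N0.
  - by move=> k Nk; rewrite CA// DA// hN.
  - by move=> k kN; rewrite mul_vec_sylvester CA// DA// mul1mx mulmx1 subrr linear0.
  pose P : 'M[fps E]_n := \matrix_(i, j) (fun k => vec_mx (x k) i j).
  have PE k : coefmx k P = vec_mx (x k).
    by apply/matrixP => i j; rewrite /coefmx /P !mxE.
  exists P; first by apply/horizontal_solution => k; rewrite PE vec_mxK xE;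
    apply: eq_bigr => i _; rewrite PE vec_mxK.
  move=> k kN; rewrite PE coefmx1; have [->|k0] := posnP k.
    by rewrite x0 mxvecK.
  by rewrite xN ?k0// linear0 raddf0.
(* The identity is horizontal from [C] to itself, so [X - 1] is a solution vanishing below [N]. *)
have uniq (C X : 'M[fps E]_n) : coefmx 0 C = coefmx 0 A ->
    thetamx X = X *m C - C *m X ->
    (forall k, (k < N)%N -> coefmx k X = coefmx k 1%:M) -> X = 1%:M.
  move=> CA XE XN; apply/eqP; rewrite -subr_eq0; apply/eqP.
  have YE : thetamx (X - 1%:M) = (X - 1%:M) *m C - C *m (X - 1%:M).
    rewrite mulmxBl mulmxBr mul1mx mulmx1 opprB addrA subrK -XE.
    apply: coefmxP => k; rewrite !coefmx_theta coefmxB scalerBr coefmx1.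
    case: k => [|k]; first by rewrite !scale0r subrr.
    by rewrite -scalemx1 scale0r scaler0 subr0.
  apply: coefmxP => k; apply: (can_inj mxvecK).
  have -> : mxvec (coefmx k (0 : 'M[fps E]_n)) = 0.
    by apply/rowP => i; case/mxvec_indexP: i => i j; rewrite mxvecE !mxE.
  apply: (solution_unique (N := N) ((horizontal_solution _ _ _).1 YE)).
    by move=> l Nl; rewrite CA hN.
  by move=> l lN; rewrite coefmxB XN// subrr linear0.
have prod1 (X Y : 'M[fps E]_n) :
    (forall k, (k < N)%N -> coefmx k X = coefmx k 1%:M) ->
    (forall k, (k < N)%N -> coefmx k Y = coefmx k 1%:M) ->
    forall k, (k < N)%N -> coefmx k (X *m Y) = coefmx k 1%:M.
  move=> hX hY k kN; rewrite coefmxM -[in RHS](mulmx1 1%:M) coefmxM.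
  apply: eq_bigr => s _; rewrite hX ?hY//.
    by rewrite (leq_ltn_trans (leq_subr _ _)).
  by rewrite (leq_trans (ltn_ord s)).
have [P PE PN] := ex A B (fun _ _ => erefl) AB.
have [Q QE QN] := ex B A AB (fun _ _ => erefl).
exists P, Q; split=> //.
- apply: (uniq B) => //; last exact: prod1.
  rewrite thetamxM PE QE mulmxBl mulmxBr !mulmxA.
  by rewrite addrC addrA subrK.
- apply: (uniq A) => //; last exact: prod1.
  rewrite thetamxM PE QE mulmxBl mulmxBr !mulmxA.
  by rewrite addrC addrA subrK.
Qed.

End Gauge.

(** * Convergence of horizontal matrices *)

Section Convergent.
Variables (R : realType) (E : fieldType) (v : absval R E).

Lemma convergent_common (s : seq (fps E)) :
  (forall a, a \in s -> a \in convergent v) ->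
  exists r K : R, [/\ 0 < r, 0 <= K &
    forall a n, a \in s -> v (a n) * r ^+ n <= K].
Proof.
elim: s => [|a s IH] sP; first by exists 1, 0.
have [b bs|r [K [r0 K0 hK]]] := IH; first by apply: sP; rewrite inE bs orbT.
have /asboolP/radius_gt0P[r' [K' [r'0 hK']]] : a \in convergent v.
  by apply: sP; rewrite inE eqxx.
have m0 : 0 <= Num.min r' r by rewrite le_min !ltW.
exists (Num.min r' r), (Num.max K' K); split; first by rewrite lt_min r'0.
  by rewrite le_max K0 orbT.
move=> b n; rewrite inE le_max => /orP[/eqP->|bs].
  apply/orP; left; apply: le_trans (hK' n); apply: ler_wpM2l; rewrite ?av_ge0//.
  by apply: lerXn2r; rewrite ?nnegrE// ?ge_min ?lexx// ltW.
apply/orP; right; apply: le_trans (hK b n bs); apply: ler_wpM2l; rewrite ?av_ge0//.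
by apply: lerXn2r; rewrite ?nnegrE// ?ge_min ?lexx ?orbT// ltW.
Qed.

(** Entries of the Sylvester matrix combine those of [A] and [B] with coefficients 0 and 1 up to
    sign, and ultrametric sums do not grow. *)
Lemma av_sylvester_le m n (A : 'M[E]_n) (B : 'M[E]_m) C : 0 <= C ->
  (forall i j, v (A i j) <= C) -> (forall i j, v (B i j) <= C) ->
  forall i j, v (sylvester A B i j) <= C.
Proof.
move=> C0 AC BC i j; case/mxvec_indexP: i => i i'; case/mxvec_indexP: j => j j'.
rewrite !mxE !mxvecE vec_mx_delta /= (le_trans (av_ultra _ _ _))// avN.
have h x y : v x <= 1 -> v y <= C -> v (x * y) <= C.
  move=> x1 yC; rewrite avM -[C]mul1r ler_pM ?av_ge0//.
rewrite ge_max !mxE; apply/andP; split; apply: av_big_le => // l _.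
  by apply: h => //; rewrite mxE av_nat.
by rewrite mulrC; apply: h => //; rewrite mxE av_nat.
Qed.

Lemma convergent_shift (a : fps E) :
  a \in convergent v -> (fun n => a n.+1 : E) \in convergent v.
Proof.
move=> /asboolP/radius_gt0P[r [C [r0 hC]]]; apply/asboolP/radius_gt0P.
exists r, (C / r); split=> // n; rewrite ler_pdivlMr// -mulrA -exprSr.
exact: hC.
Qed.

Lemma convergent_truncation N (a : fps E) :
  (fun n => if (n < N)%N then a n else 0 : E) \in convergent v.
Proof.
apply: (@convergent_bounded _ _ _ _ (\sum_(n < N) v (a n))) => n.
have s0 : 0 <= \sum_(n < N) v (a n) by apply: sumr_ge0 => i _; exact: av_ge0.
case: ltnP => [nN|_]; last by rewrite av0.
rewrite (bigD1 (Ordinal nN))//= lerDl; apply: sumr_ge0 => i _; exact: av_ge0.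
Qed.

Variables (p : nat) (F : closedFieldType) (iota : {rmorphism E -> F}).
Variable w : absval R F.
Hypotheses (p_pr : prime p) (F0 : [pchar F] =i pred0).
Hypotheses (vp : v p%:R = p%:R^-1) (wv : forall x, w (iota x) = v x).

(** A common bound for [A] and [B] passes to the Sylvester matrices, and the eigenvalues of the
    constant one are differences [alpha - beta], so [recursion_bound] applies to the flattened
    [X]. *)
Lemma horizontal_convergent m n (A : 'M[fps E]_n) (B : 'M[fps E]_m)
    (X : 'M[fps E]_(m, n)) :
  (forall i j, A i j \in convergent v) -> (forall i j, B i j \in convergent v) ->
  (forall alpha beta, root (char_poly (map_mx iota (coefmx 0 A))) alpha ->
    root (char_poly (map_mx iota (coefmx 0 B))) beta ->
    (0 < ptype w (alpha - beta))%E) ->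
  thetamx X = X *m A - B *m X -> forall i j, X i j \in convergent v.
Proof.
move=> Ac Bc AB /horizontal_solution XE i j.
pose s := [seq A ij.1 ij.2 | ij : 'I_n * 'I_n] ++
          [seq B ij.1 ij.2 | ij : 'I_m * 'I_m].
have [a|r [K [r0 K0 hK]]] := @convergent_common s.
  by rewrite mem_cat => /orP[] /codomP[ij ->].
have [|l lP|r' [C [r'0 hC]]] :=
    @recursion_bound R p E F iota v w p_pr F0 vp wv _ _ _ XE r K r0.
- move=> k a b; have rk : 0 < r ^+ k by rewrite exprn_gt0.
  rewrite -ler_pdivlMr//; apply: av_sylvester_le => [|a' b'|a' b'].
  + by rewrite divr_ge0// ltW.
  + rewrite mxE ler_pdivlMr// hK// mem_cat; apply/orP; left.
    by apply/codomP; exists (a', b').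
  + rewrite mxE ler_pdivlMr// hK// mem_cat; apply/orP; right.
    by apply/codomP; exists (a', b').
- move: lP; rewrite -eigenvalue_root_char map_sylvester.
  move=> /vec_sylvester_eigen[Y YE Y0].
  by have [a [b [ra rb ->]]] := sylvester_eigenvalue Y0 YE; exact: AB.
apply/asboolP/radius_gt0P; exists r', C; split=> // k.
by have := hC k (mxvec_index i j); rewrite mxvecE mxE.
Qed.

End Convergent.

(** * Evaluation at [z = 0] for both rings *)

Section Evaluation.
Variables (R : realType) (E : fieldType) (v : absval R E).

Definition fps_ev (a : fps E) : E := a 0%N.

Lemma fps_ev_zmod : zmod_morphism fps_ev. Proof. by []. Qed.
Lemma fps_evM : monoid_morphism fps_ev.
Proof. by split=> // a b; rewrite /fps_ev fpsME big_ord1. Qed.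
HB.instance Definition _ :=
  GRing.isZmodMorphism.Build (fps E) E fps_ev fps_ev_zmod.
HB.instance Definition _ :=
  GRing.isMonoidMorphism.Build (fps E) E fps_ev fps_evM.

Lemma fps_zM (b : fps E) n : (fps_z E * b) n.+1 = b n.
Proof.
rewrite fpsME !big_ord_recl /= /fps_z mul0r add0r mul1r subSS subn0.
by rewrite big1 ?addr0// => i _; rewrite mul0r.
Qed.

Lemma fps_zM_shift (a : fps E) : a 0%N = 0 ->
  a = fps_z E * (fun n => a n.+1 : E).
Proof.
move=> a0; apply/funext => -[|n]; last by rewrite fps_zM.
by rewrite a0 fpsME big_ord1 /fps_z mul0r.
Qed.

Definition Ohat_ev : {rmorphism Ohat E -> E} := fps_ev.
Definition Odagger_ev : {rmorphism Odagger v -> E} :=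
  (fps_ev \o (val : cps v -> fps E)).

Lemma Ohat_evP : is_eval Ohat_ev.
Proof. by split=> [//|//|a a0]; exists (fun n => a n.+1); exact: fps_zM_shift. Qed.

Lemma Odagger_evP : is_eval Odagger_ev.
Proof.
split=> [//|//|a a0]; exists (Cps (convergent_shift (cps_valP a))).
by apply: val_inj; exact: fps_zM_shift.
Qed.

End Evaluation.

(** * Fullness and essential surjectivity of base change *)

Section Descent.
Variables (R : realType) (p : nat) (E : fieldType) (F : closedFieldType).
Variables (iota : {rmorphism E -> F}) (v : absval R E) (w : absval R F).
Variable S : set F.
Hypotheses (p_pr : prime p) (F0 : [pchar F] =i pred0).
Hypotheses (vp : v p%:R = p%:R^-1) (wv : forall x, w (iota x) = v x).
Hypothesis SB : forall x y, S x -> S y -> S (x - y).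
Hypothesis Stype : forall x, S x -> (0 < ptype w x)%E.

Local Notation h := (Odagger_to_Ohat v).

Lemma Odagger_to_Ohat_inj : injective h.
Proof. exact: (@val_inj _ _ (cps v)). Qed.

Lemma residue_bc (M : dmod (Odagger v)) n (e : 'I_n -> M) k : coords e k ->
  residue (Ohat_ev E) (M := dbc h M) (fun i => bpure h 1 (e i))
    (@bc_coord _ _ h _ _ k) = residue (Odagger_ev v) e k.
Proof.
move=> ck; apply/matrixP => i j; rewrite !mxE /=.
by rewrite bc_nabla_bpure1 (bc_coordE _ ck) mul1r.
Qed.

(** The basis [1 (x) e i] has the same connection matrix, hence the same residue. *)
Lemma exponent_bc (M : dmod (Odagger v)) lambda : finite_free M ->
  exponent iota (Z := Ohat E) (dbc h M) lambda <-> exponent iota M lambda.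
Proof.
move=> /finite_free_ord[n [e [k ck]]].
have cb : @coords (Ohat E) (dbc h M) _ _ _ := coords_bc h ck.
apply: (iff_trans (exponent_root (@Ohat_evP E) iota lambda cb)).
rewrite residue_bc//.
exact: iff_sym (exponent_root (@Odagger_evP _ _ v) iota lambda ck).
Qed.

(** Once the matrix of [g] is known to converge, [g] sends [1 (x) M] into [1 (x) N] and
    [dhom_descent] applies. *)
Lemma base_change_full (M N : dmod (Odagger v)) (g : dhom (dbc h M) (dbc h N)) :
  finite_free M -> finite_free N ->
  (forall l, exponent iota M l -> S l) -> (forall l, exponent iota N l -> S l) ->
  exists f : dhom M N, dbcm h f = g.
Proof.
move=> fM fN SM SN; apply: (dhom_descent Odagger_to_Ohat_inj fN).
have [m [e [k ck]]] := finite_free_ord fM.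
have [n [f [l cl]]] := finite_free_ord fN.
have cM : @coords (Ohat E) (dbc h M) _ _ _ := coords_bc h ck.
have cN : @coords (Ohat E) (dbc h N) _ _ _ := coords_bc h cl.
pose A : 'M[fps E]_m := \matrix_(i, j) h (k i (nabla (e j))).
pose B : 'M[fps E]_n := \matrix_(i, j) h (l i (nabla (f j))).
pose X : 'M[fps E]_(n, m) :=
  \matrix_(i, j) (@bc_coord _ _ h _ _ l i (g (bpure h 1 (e j)))).
have XE : thetamx X = X *m A - B *m X.
  apply/matrixP => i j; rewrite !mxE.
  have := dhom_matrix g i j cM cN => /= ->; congr (_ - _).
    apply: eq_bigr => s _; rewrite !mxE.
    by rewrite bc_nabla_bpure1 (bc_coordE _ ck) mul1r.
  apply: eq_bigr => s _; rewrite !mxE.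
  by rewrite bc_nabla_bpure1 (bc_coordE _ cl) mul1r.
have Xc i j : X i j \in convergent v.
  move: i j; apply: (horizontal_convergent p_pr F0 vp wv _ _ _ XE).
  - by move=> i j; rewrite mxE; exact: cps_valP.
  - by move=> i j; rewrite mxE; exact: cps_valP.
  move=> a b ra rb; apply: Stype; apply: SB.
    apply: SM; apply/(exponent_root (@Odagger_evP _ _ v) iota a ck).
    by congr (is_true (root (char_poly (map_mx iota _)) a)): ra;
      apply/matrixP => i j; rewrite !mxE.
  apply: SN; apply/(exponent_root (@Odagger_evP _ _ v) iota b cl).
  by congr (is_true (root (char_poly (map_mx iota _)) b)): rb;
    apply/matrixP => i j; rewrite !mxE.
have gE j : g (bpure h 1 (e j)) =
    bpure h 1 (\sum_i (Cps (Xc i j) : Odagger v) *: f i).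
  apply: (coords_inj cN) => i; rewrite (bc_coordE _ cl) mul1r.
  by rewrite (coords_sum cl) /= mxE.
move=> x; exists (\sum_j k j x *: \sum_i (Cps (Xc i j) : Odagger v) *: f i).
rewrite (dhom_coords cM) bpure1_sum; apply: eq_bigr => j _.
by rewrite gE (bc_coordE _ ck) mul1r.
Qed.

(** The inclusion of exponents places [M] in the subcategory whenever [N] is; it holds because
    truncating at a positive order keeps the constant term of the connection matrix. *)
Lemma base_change_esurj (N : dmod (Ohat E)) : finite_free N ->
  exists (M : dmod (Odagger v)) (f : dhom (dbc h M) N) (g : dhom N (dbc h M)),
  [/\ finite_free M,
      forall l, exponent iota M l -> exponent iota (Z := Ohat E) N l,
      dhom_comp g f = dhom_id _ & dhom_comp f g = dhom_id _].
Proof.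
move=> fN; have [n [e [k ck]]] := finite_free_ord fN.
pose A : 'M[fps E]_n := \matrix_(i, j) k i (nabla (e j)).
have [K K0 hK] := gauge_truncation iota F0 A.
pose B : 'M[cps v]_n := \matrix_(i, j) Cps (convergent_truncation v K (A i j)).
have BA s : (s < K)%N -> coefmx s (map_mx val B) = coefmx s A.
  by move=> sK; apply/matrixP => i j; rewrite !mxE /= sK.
have [P [Q [PQ QP PE QE]]] := hK _ BA.
pose M : dmod (Odagger v) := @dmod_of_mx (Odagger v) n B.
have cM : @coords (Odagger v) M _ _ _ := @coords_dmod_of_mx (Odagger v) n B.
have cb : @coords (Ohat E) (dbc h M) _ _ _ := coords_bc h cM.
have BE : \matrix_(i, j) (bc_coord (fun i (x : M) => (x : 'cV[cps v]_n) i 0) i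
    (@nabla _ (dbc h M) (bpure h 1 (delta_mx j 0 : 'cV[cps v]_n)))) =
    map_mx val B :> 'M[fps E]_n.
  apply/matrixP => i j; rewrite [LHS]mxE [RHS]mxE [nabla _]bc_nabla_bpure1.
  rewrite (bc_coordE _ cM) mul1r.
  exact: (congr1 val (@dmod_of_mxE (Odagger v) n B i j)).
have [f fE] := dhom_of_matrix cb ck (U := Q)
  (etrans QE (congr1 (fun Y => Q *m Y - A *m Q) (esym BE))).
have [g gE] := dhom_of_matrix ck cb (U := P)
  (etrans PE (congr1 (fun Y => P *m A - Y *m P) (esym BE))).
exists M, f, g; split.
- by apply/finite_freeP; do 3 eexists; exact: cM.
- move=> l /(exponent_root (@Odagger_evP _ _ v) iota l cM) rl.
  apply/(exponent_root (@Ohat_evP E) iota l ck).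
  congr (is_true (root (char_poly (map_mx iota _)) l)): rl.
  apply/matrixP => i j; transitivity (fps_ev (val (B i j))).
    rewrite [LHS]mxE.
    exact: (congr1 (fun b => fps_ev (val b)) (@dmod_of_mxE (Odagger v) n B i j)).
  by have /matrixP/(_ i j) := BA 0%N K0; rewrite !mxE.
- exact: (dhom_comp_matrix1 cb fE gE PQ).
- exact: (dhom_comp_matrix1 ck gE fE QP).
Qed.

End Descent.

Theorem theorem11p3 (R : realType) (p : nat) (E : fieldType)
  (Ebar : closedFieldType) (iota : {rmorphism E -> Ebar})
  (v : absval R E) (w : absval R Ebar) (S : set Ebar) :
  prime p ->
  [pchar E] =i pred0 ->
  v p%:R = p%:R^-1 ->
  (forall x : Ebar, algebraicOver iota x) ->
  (forall x : E, w (iota x) = v x) ->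
  (forall n : int, S n%:~R) ->
  (forall x y, S x -> S y -> S (x - y)) ->
  (forall x, S x -> (0 < ptype w x)%E) ->
  exists (stdag : tensor_stable (exponents_in iota (Z := Odagger v) S))
         (sthat : tensor_stable (exponents_in iota (Z := Ohat E) S))
         (bcS : forall M : MIC (Odagger v), exponents_in iota S M ->
            exponents_in iota (Z := Ohat E) S
              (base_change (Odagger_to_Ohat v) M)),
    is_tensor_equivalence
      (full_tensor_functor (F := base_change (Odagger_to_Ohat v))
         stdag sthat bcS).
Proof.
move=> p_pr E0 vp _ wv SZ SB Stype.
have F0 : [pchar Ebar] =i pred0 by move=> q; rewrite (fmorph_pchar iota) E0.
have S0 : S 0 by have := SZ 0; rewrite mulr0z.
exists (exponents_tensor_stable iota (@Odagger_evP _ _ v) S0 SB).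
exists (exponents_tensor_stable iota (@Ohat_evP E) S0 SB).
have bcS : forall M : MIC (Odagger v), exponents_in iota S M ->
    exponents_in iota (Z := Ohat E) S (base_change (Odagger_to_Ohat v) M).
  by move=> [M fM] SM l /(exponent_bc iota l fM)/SM.
exists bcS; apply: is_equivalence_full_faithful_esurj.
- move=> [[M fM] SM] [[N fN] SN] f g.
  exact: (dbcm_inj (@Odagger_to_Ohat_inj _ _ v) fN).
- move=> [[M fM] SM] [[N fN] SN] g.
  exact: (base_change_full p_pr F0 vp wv SB Stype g fM fN SM SN).
- move=> [[N fN] SN].
  have [M [f [g [fM MN gf fg]]]] := base_change_esurj iota v F0 fN.
  pose M' : MIC (Odagger v) := exist _ M fM.
  have SM : exponents_in iota (Z := Odagger v) S M' by move=> l /MN/SN.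
  by exists (exist _ M' SM), f, g.
Qed.
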